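(* Let $\mathcal X$ be a minimal non-periodic subshift, and let $x\in\mathcal X$. Let $A$ be the set of letters occurring in $\mathcal X$. Suppose there is a subgroup $K$ of $FG(A)$ and an infinite set $P$ of positive integers such that, for every $n\in P$, the set $R_n(x)$ is a free basis of $K$. Let $\overline K$ be the topological closure of $K$ in $\overline{\Omega}_A\mathsf G$. Then the restriction to $G_x$ of the canonical projection $p_{\mathsf G}\colon\overline{\Omega}_A\mathsf S\to\overline{\Omega}_A\mathsf G$ is a continuous isomorphism from $G_x$ onto $\overline K$.
   Context: Subshifts. Alphabets are finite sets with the discrete topology, $A^{\mathbb Z}$ has the product topology, and $\sigma((x_i)_{i\in\mathbb Z})=(x_{i+1})_{i\in\mathbb Z}$ is the shift. A subshift of $A^{\mathbb Z}$ is a nonempty closed $\mathcal X\subseteq A^{\mathbb Z}$ with $\sigma(\mathcal X)=\mathcal X$; it is minimal if it contains no proper subshift, and periodic if it is the finite set $\{\sigma^k(y)\mid 0\le k<N\}$ for some $y$ with $\sigma^N(y)=y$, $N\geq 1$. Write $x_{[i,j]}=x_ix_{i+1}\cdots x_j$; $L(\mathcal X)$ is the set of finite blocks $x_{[i,j]}$ ($i\le j$) of elements $x\in\mathcal X$. Free objects. $A^+$ is the free semigroup on $A$, $FG(A)$ the free group on $A$ (so $A^+\subseteq FG(A)$), $\overline{\Omega}_A\mathsf S$ the free profinite semigroup generated by $A$ (which contains $A^+$ as a dense discrete subsemigroup) and $\overline{\Omega}_A\mathsf G$ the free profinite group with basis $A$ (which contains $FG(A)$). $p_{\mathsf G}$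 is the continuous semigroup homomorphism $\overline{\Omega}_A\mathsf S\to\overline{\Omega}_A\mathsf G$ that is the identity on $A$. The group $G_x$. Let $\overline{L(\mathcal X)}$ be the closure of $L(\mathcal X)$ in $\overline{\Omega}_A\mathsf S$; it contains a unique regular $\mathcal J$-class $J(\mathcal X)$ such that every element of $\overline{L(\mathcal X)}$ is a factor of every element of $J(\mathcal X)$ (for $\mathcal X$ minimal, $J(\mathcal X)=\overline{L(\mathcal X)}\setminus A^+$). Every $u\in\overline{\Omega}_A\mathsf S\setminus A^+$ has, for every $k\ge 1$, a unique prefix and a unique suffix in $A^+$ of length $k$. For $x\in\mathcal X$, $G_x$ is the set of $u\in J(\mathcal X)$ such that, for every $k\ge1$, $x_{[0,k-1]}$ is a prefix of $u$ and $x_{[-k,-1]}$ is a suffix of $u$; it is known that $G_x$ is a maximal subgroup of $J(\mathcal X)$. Return words. For $u\in L(\mathcal X)$, $R(u)$ is the set of words $v\in A^+$ such that $vu\in L(\mathcal X)\cap uA^+$ and $u$ occurs in $vu$ only as a prefix and as a suffix. For words $u_1,u_2$ with $u_1u_2=u\in L(\mathcal X)$, $R(u_1,u_2)$ is the set of words $v$ such that $u_1vu_2\in L(\mathcal X)$ and $u_1v\in R(u)u_1$. For $n\ge1$, $R_n(x)=R(x_{[-n,-1]},x_{[0,n-1]})$. *)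

(* Defs.v *)
From HB Require Import structures.
From mathcomp Require Import all_boot all_algebra.
From mathcomp Require Import all_classical all_reals topology.

Set Implicit Arguments.
Unset Strict Implicit.
Unset Printing Implicit Defensive.

Import GRing.Theory.

Local Open Scope classical_set_scope.
Local Open Scope group_scope.

(* Free groups are realized by reduced words over A * bool, where (a, true)
   stands for the inverse of a. *)

Section FreeGroup.
Variable A : choiceType.
Implicit Types (l m : A * bool) (u v w : seq (A * bool)).

Definition letter_inv l : A * bool := (l.1, ~~ l.2).

Definition reduced w : bool := sorted (fun l m => m != letter_inv l) w.

Definition red_cons l w : seq (A * bool) :=
  if w is m :: w' then if m == letter_inv l then w' else l :: w else [:: l].

Definition red_cat u v : seq (A * bool) := foldr red_cons v u.

Definition word_inv w : seq (A * bool) := rev (map letter_inv w).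

Lemma letter_invK : involutive letter_inv.
Proof. by case=> a b; rewrite /letter_inv /= negbK. Qed.

Lemma reduced_behead l w : reduced (l :: w) -> reduced w.
Proof. exact: path_sorted. Qed.

Lemma reduced_red_cons l w : reduced w -> reduced (red_cons l w).
Proof.
case: w => [//|m w] rw /=; case: ifPn => [_|ne]; first exact: reduced_behead rw.
by rewrite /reduced /= ne.
Qed.

Lemma red_consE l w : reduced (l :: w) -> red_cons l w = l :: w.
Proof. by case: w => [//|m w] /= /andP[/negbTE ->]. Qed.

Lemma red_consK l w : reduced w -> red_cons l (red_cons (letter_inv l) w) = w.
Proof.
case: w => [_|m w rw] /=; first by rewrite eqxx.
rewrite letter_invK; case: eqP => [e|_] /=; last by rewrite eqxx.
by rewrite -e red_consE.
Qed.

Lemma reduced_red_cat u v : reduced v -> reduced (red_cat u v).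
Proof. by move=> rv; elim: u => //= l u; exact: reduced_red_cons. Qed.

Lemma red_cat0 u : reduced u -> red_cat u [::] = u.
Proof.
elim: u => //= l u IH ru; rewrite IH ?red_consE //; exact: reduced_behead ru.
Qed.

Lemma red_cat_cons l u w : reduced w ->
  red_cat (red_cons l u) w = red_cons l (red_cat u w).
Proof.
case: u => //= m u rw; case: eqP => [->|_] //=.
by rewrite red_consK // reduced_red_cat.
Qed.

Lemma red_catA u v w : reduced w ->
  red_cat u (red_cat v w) = red_cat (red_cat u v) w.
Proof.
by move=> rw; elim: u => //= l u IH; rewrite red_cat_cons ?IH.
Qed.

Lemma word_invK : involutive word_inv.
Proof.
by move=> w; rewrite /word_inv map_rev revK mapK //; exact: letter_invK.
Qed.

Lemma red_catV u w : reduced w -> red_cat u (red_cat (word_inv u) w) = w.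
Proof.
elim: u w => //= l u IH w rw.
rewrite /word_inv /= rev_cons -cats1 /red_cat foldr_cat -/(red_cat _ _) /=.
by rewrite -[foldr _ _ _]/(red_cat (word_inv u) _) IH ?red_consK // reduced_red_cons.
Qed.

Lemma reduced_word_inv w : reduced w -> reduced (word_inv w).
Proof.
rewrite /reduced /word_inv rev_sorted sorted_map; apply: sub_sorted => l m /=.
by rewrite letter_invK; apply: contra => /eqP ->.
Qed.

Definition FG : Type := {w : seq (A * bool) | reduced w}.
HB.instance Definition _ := Choice.on FG.

Definition FG_one : FG := exist _ [::] isT.
Definition FG_inv (g : FG) : FG :=
  exist _ (word_inv (val g)) (reduced_word_inv (valP g)).
Definition FG_mul (g h : FG) : FG :=
  exist _ (red_cat (val g) (val h)) (reduced_red_cat (val g) (valP h)).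

Fact FG_mulA : associative FG_mul.
Proof. by move=> g h k; apply: val_inj; apply: red_catA; exact: valP. Qed.

Fact FG_mul1 : left_id FG_one FG_mul.
Proof. by move=> g; apply: val_inj. Qed.

Fact FG_mulg1 : right_id FG_one FG_mul.
Proof. by move=> g; apply: val_inj; apply: red_cat0; exact: valP. Qed.

Fact FG_mulV : left_inverse FG_one FG_inv FG_mul.
Proof.
move=> g; apply: val_inj => /=.
by have := @red_catV (word_inv (val g)) [::] isT; rewrite word_invK red_cat0 ?(valP g).
Qed.

Fact FG_mulgV : right_inverse FG_one FG_inv FG_mul.
Proof.
move=> g; apply: val_inj => /=.
have := @red_catV (val g) [::] isT; rewrite [red_cat (word_inv _) _]red_cat0 //.
exact: reduced_word_inv (valP g).
Qed.

HB.instance Definition _ :=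
  isGroup.Build FG FG_mulA FG_mul1 FG_mulg1 FG_mulV FG_mulgV.

Definition FG_gen (a : A) : FG := exist _ [:: (a, false)] isT.

Definition FG_word (w : seq A) : FG := \prod_(a <- w) FG_gen a.

Section Lift.
Variables (G : groupType) (f : A -> G).

Definition letter_val l : G := if l.2 then (f l.1)^-1 else f l.1.

Definition FG_lift (g : FG) : G := \prod_(l <- val g) letter_val l.

Fact FG_lift_is_multiplicative : {morph FG_lift : g h / g * h}.
Proof.
move=> g h; rewrite /FG_lift /=; elim: (val g) => [|l u IH] /=.
  by rewrite big_nil mul1g.
rewrite big_cons -mulgA -IH; move: (red_cat u _) => [|m w] /=.
  by rewrite big_seq1 big_nil mulg1.
case: eqP => [->|_]; rewrite !big_cons //= mulgA.
by case: l => a [] /=; rewrite /letter_val /= ?mulVg ?mulgV mul1g.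
Qed.

Lemma FG_lift_gen a : FG_lift (FG_gen a) = f a.
Proof. by rewrite /FG_lift /= big_seq1. Qed.

End Lift.
End FreeGroup.

Definition subgroup (G : groupType) (K : set G) : Prop :=
  [/\ K 1, forall g h, K g -> K h -> K (g * h) & forall g, K g -> K g^-1].

(* The homomorphism from the free group on B extending the inclusion of B is an
   isomorphism onto K. *)
Definition free_basis (G : groupType) (B K : set G) : Prop :=
  injective (FG_lift (fun b : B => set_val b)) /\
  range (FG_lift (fun b : B => set_val b)) = K.

HB.mixin Record isTopologicalSemigroup S & Topological S & Semigroup S := {
  mulg_continuous : continuous (fun uv : S * S => uv.1 * uv.2)
}.

#[short(type="topSemigroupType")]
HB.structure Definition TopSemigroup :=
  {S of Topological S & Semigroup S & isTopologicalSemigroup S}.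

HB.mixin Record isTopologicalGroup G & Topological G & Group G := {
  invg_continuous : continuous (fun g : G => g^-1)
}.

#[short(type="topGroupType")]
HB.structure Definition TopGroup :=
  {G of TopSemigroup G & Group G & isTopologicalGroup G}.

(* Continuous homomorphisms into finite discrete semigroups separate points; in
   particular S is Hausdorff. *)
Definition profinite_semigroup (S : topSemigroupType) : Prop :=
  compact [set: S] /\
  forall u v : S, u <> v ->
    exists (F : semigroupType) (f : S -> F),
      [/\ finite_set [set: F], {morph f : s t / s * t},
          continuous (f : S -> discrete_topology F) & f u <> f v].

Definition profinite_group (G : topGroupType) : Prop :=
  compact [set: G] /\
  forall u v : G, u <> v ->
    exists (F : groupType) (f : G -> F),
      [/\ finite_set [set: F], {morph f : s t / s * t},
          continuous (f : G -> discrete_topology F) & f u <> f v].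

Definition free_profinite_semigroup (A : finType) (S : topSemigroupType)
    (iota : A -> S) : Prop :=
  profinite_semigroup S /\
  forall (T : topSemigroupType) (f : A -> T), profinite_semigroup T ->
    exists! phi : S -> T,
      [/\ continuous phi, {morph phi : s t / s * t} & phi \o iota = f].

Definition free_profinite_group (A : finType) (G : topGroupType)
    (iota : A -> G) : Prop :=
  profinite_group G /\
  forall (H : topGroupType) (f : A -> H), profinite_group H ->
    exists! phi : G -> H,
      [/\ continuous phi, {morph phi : s t / s * t} & phi \o iota = f].

Section Semigroup.
Variable S : semigroupType.
Implicit Types u v e : S.

(* The product of S^1; [None] is the adjoined identity. *)
Definition mul1 (p q : option S) : option S :=
  match p, q with
  | Some u, Some v => Some (u * v)
  | Some _, None => p
  | None, _ => q
  end.

Definition factor u v : Prop :=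
  exists p q : option S, Some v = mul1 (mul1 p (Some u)) q.

Definition Jclass u : set S := [set v | factor u v /\ factor v u].

Definition regular u : Prop := exists v, u = u * v * u.

Definition regular_Jclass (J : set S) : Prop :=
  exists2 u, regular u & J = Jclass u.

Definition semigroup_subgroup (H : set S) : Prop :=
  (forall u v, H u -> H v -> H (u * v)) /\
  exists e, [/\ H e, forall u, H u -> e * u = u /\ u * e = u &
    forall u, H u -> exists v, [/\ H v, u * v = e & v * u = e]].

End Semigroup.

Definition continuous_isomorphism (S : topSemigroupType) (G : topGroupType)
    (H : set S) (L : set G) (f : S -> G) : Prop :=
  [/\ semigroup_subgroup H, subgroup L, set_bij H L f,
      forall u v, H u -> H v -> f (u * v) = f u * f v &
      {within H, continuous f}].

Section Subshifts.
Variable A : finType.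

Definition shift_space := {ptws int -> discrete_topology A}.
Implicit Types (X Y : set shift_space) (x y : shift_space) (u v w : seq A).

Definition shift_map x : shift_space := fun i => x (i + 1)%R.

Definition subshift X : Prop := [/\ X !=set0, closed X & shift_map @` X = X].

Definition minimal_subshift X : Prop :=
  subshift X /\ forall Y, subshift Y -> Y `<=` X -> Y = X.

Definition periodic X : Prop :=
  exists (y : shift_space) (N : nat),
    [/\ (0 < N)%N, iter N shift_map y = y & X = [set iter k shift_map y | k in `I_N]].

(* x_i x_(i+1) ... x_(i+n-1) *)
Definition block x (i : int) (n : nat) : seq A :=
  [seq (x (i + k%:Z)%R : A) | k <- iota 0 n].

Definition language X : set (seq A) :=
  [set w | exists x i n, [/\ X x, (0 < n)%N & w = block x i n]].

Definition return_words X u : set (seq A) :=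
  [set v | [/\ v <> [::], language X (v ++ u),
    exists2 t, t <> [::] & v ++ u = u ++ t &
    forall p s, v ++ u = p ++ u ++ s -> p = [::] \/ s = [::]]].

Definition return_words2 X u1 u2 : set (seq A) :=
  [set v | language X (u1 ++ v ++ u2) /\
    exists2 r, return_words X (u1 ++ u2) r & u1 ++ v = r ++ u1].

Definition Rn X x (n : nat) : set (seq A) :=
  return_words2 X (block x (- n%:Z)%R n) (block x 0%R n).

Section MaximalSubgroup.
Variables (S : topSemigroupType) (iota : A -> S).

Definition pword (w : seq A) : option S :=
  foldr (fun a => mul1 (Some (iota a))) None w.

Definition language_closure X : set S :=
  closure [set u | exists2 w, language X w & pword w = Some u].

(* Two such classes J consist of factors of each other's elements, hence are
   equal: the union below is over at most one class. *)
Definition JX X : set S :=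
  [set u | exists J : set S,
    [/\ regular_Jclass J, J `<=` language_closure X,
        forall s t, J s -> language_closure X t -> factor t s & J u]].

Definition pprefix (w : seq A) (u : S) : Prop :=
  exists q, Some u = mul1 (pword w) q.

Definition psuffix (w : seq A) (u : S) : Prop :=
  exists p, Some u = mul1 p (pword w).

Definition Gx X x : set S :=
  [set u | JX X u /\ forall k : nat, (0 < k)%N ->
    pprefix (block x 0%R k) u /\ psuffix (block x (- k%:Z)%R k) u].

End MaximalSubgroup.
End Subshifts.

(* Main.v *)
From HB Require Import structures.
From mathcomp Require Import all_boot all_algebra all_fingroup.
From mathcomp Require Import finmap zify.
From mathcomp Require Import all_classical topology.
Require Import Defs.

Set Implicit Arguments.
Unset Strict Implicit.
Unset Printing Implicit Defensive.

Local Open Scope classical_set_scope.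
Local Open Scope group_scope.

(** Let [L] be the language of [X], with closure taken in the free profinite semigroup
   [S]. Multiplication in [S] is open ([lift_factorization]): a word near a product is
   a product of words near its factors. So the closure of [L] contains the factors of
   its elements ([closure_factorial]). By
   uniform recurrence its elements whose prefixes and suffixes are read off [x] are
   the elements of [Gx] ([GxE]). They are all R-equivalent to a limit [p] of the
   words [x_0 ... x_(n-1)] and L-equivalent to a limit [q] of the words
   [x_-n ... x_-1], by stability of compact semigroups, and this makes [Gx] a closed
   subgroup of [S] ([group_at_group]).

   Two facts relate [Gx] to the return words [R_n(x)].
   - Every element of [Gx] is a limit of products of words of [R_n(x)], for each
     [n] ([group_at_returns]): if [e] is the identity then [s = e s e], and a word
     near this product contains an occurrence of [x_-n ... x_-1 w x_0 ... x_(n-1)]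
     with [w] near [s].
   - For every finite quotient [f] of [S] and all large [n], one has
     [f R_n(x) <= f Gx] ([quotient_returns]). Indeed non-periodicity makes the
     lengths of the words of [R_n(x)] tend to infinity ([Rn_long]), so that the
     limits of words [r_n] of [R_n(x)] have the prescribed prefixes and suffixes.

   Surjectivity. The image of [Gx] in the free profinite group [G] is a closed
   subgroup. By the second fact applied to a finite quotient of [G], it contains
   the generators [R_n(x)] of [K] modulo that quotient for some [n] in [P]; so it
   contains the closure of [K]. The first fact gives the other inclusion.

   Injectivity. Let [f] be a finite quotient of [S]. For a large [n] in [P] the two
   facts show that [f] maps the subsemigroup generated by [R_n(x)] onto the finite
   group [f Gx]. As [R_n(x)] is a free basis of [K], this extends to a homomorphism
   from [K] to [f Gx]. A theorem of M. Hall ([finite_quotient_extension]) provides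
   a finite quotient of the free group on [A] such that an element of [K] trivial
   there is in the kernel of that homomorphism. Hence [f] on [Gx] is determined by
   the projection to [G]. *)

(** * Finite quotients of profinite semigroups *)

Definition finite_quotient (S : topSemigroupType) (F : semigroupType)
    (f : S -> F) : Prop :=
  [/\ finite_set [set: F], {morph f : s t / s * t}
    & continuous (f : S -> discrete_topology F)].

Section Option.
Variable S : semigroupType.

Lemma mul1A : associative (@mul1 S).
Proof. by move=> [a|] [b|] [c|] //=; rewrite mulgA. Qed.

Lemma mul1N (p : option S) : mul1 p None = p.
Proof. by case: p. Qed.

(** The orders whose equivalences are Green's relations R and L. *)
Definition rdiv (v s : S) := exists z : option S, Some s = mul1 (Some v) z.
Definition ldiv (v s : S) := exists z : option S, Some s = mul1 z (Some v).

Lemma rdiv_trans u v s : rdiv u v -> rdiv v s -> rdiv u s.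
Proof. by move=> [z ez] [y ey]; exists (mul1 z y); rewrite mul1A -ez. Qed.

Lemma ldiv_trans u v s : ldiv u v -> ldiv v s -> ldiv u s.
Proof. by move=> [z ez] [y ey]; exists (mul1 y z); rewrite -mul1A -ez. Qed.

Lemma factorE (t s : S) : factor t s <-> exists m, ldiv t m /\ rdiv m s.
Proof.
split=> [[p [q e]]|[m [[p ep] [q eq]]]]; last by exists p, q; rewrite -ep.
case ep: (mul1 p (Some t)) => [m|]; last by case: p e ep.
by exists m; split; [exists p|exists q; rewrite -ep].
Qed.

Lemma factor_trans (u v s : S) : factor u v -> factor v s -> factor u s.
Proof.
move=> [p [q e]] [p' [q' e']]; exists (mul1 p' p), (mul1 q q').
by rewrite e' e !mul1A.
Qed.

End Option.

Section Cluster.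
Variable T : topologicalType.

Lemma cluster_closed (F : set_system T) (C : set T) t :
  cluster F t -> F C -> closed C -> C t.
Proof. by rewrite clusterE => ct FC cC; apply: cC; exact: ct. Qed.

Lemma seq_cluster (u : nat -> T) : compact [set: T] ->
  exists t, forall C : set T, closed C -> (\forall n \near \oo, C (u n)) -> C t.
Proof.
move=> cT; have [t [_ ct]] := cT (u @ \oo) _ (@filterT _ _ _).
by exists t => C cC nC; exact: cluster_closed ct nC cC.
Qed.

(** Kuratowski's theorem: the fibres over the points near [u] generate a filter on the
   compact factor, and its cluster points lie in the fibre over [u]. *)
Lemma closed_proj (U : topologicalType) (C : set (U * T)) :
  compact [set: T] -> closed C -> closed [set u | exists v, C (u, v)].
Proof.
move=> cT cC u cu.
pose FF : set_system T := [set V | exists2 W, nbhs u W &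
  forall u' v, W u' -> C (u', v) -> V v].
have FFF : ProperFilter FF.
  apply: Build_ProperFilter_ex.
    by move=> V [W nW sW]; have [u' [[v Cv] Wu']] := cu _ nW; exists v; exact: sW Cv.
  split.
  - by exists setT => //; exact: filterT.
  - move=> V1 V2 [W1 n1 s1] [W2 n2 s2]; exists (W1 `&` W2); first exact: filterI.
    by move=> u' v [w1 w2] Cv; split; [exact: s1 Cv|exact: s2 Cv].
  - by move=> V1 V2 s12 [W nW sW]; exists W => // u' v w Cv; apply: s12; exact: sW Cv.
have [v [_ cv]] := cT FF FFF (@filterT _ _ _).
exists v; apply: cC => B [[B1 B2] /= [n1 n2] sB].
have FB : FF [set v' | exists2 u', B1 u' & C (u', v')].
  by exists B1 => // u' v' b1 Cv; exists u'.
have [v' [[u' b1 Cv'] b2]] := cv _ _ FB n2.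
by exists (u', v'); split=> //; apply: sB.
Qed.

End Cluster.

Section Quotients.
Variable S : topSemigroupType.

Section One.
Variables (F : semigroupType) (f : S -> F).
Hypothesis hf : finite_quotient f.

Lemma quotient_open (P : set F) : open (f @^-1` P).
Proof.
case: hf => _ _ cf.
by move/continuousP: cf => /(_ P); apply; exact: (@discrete_open (discrete_topology F)).
Qed.

Lemma quotient_closed (P : set F) : closed (f @^-1` P).
Proof.
rewrite -[P]setCK preimage_setC; apply: open_closedC; exact: (quotient_open (~` P)).
Qed.

Lemma quotient_nbhs s : nbhs s [set t | f t = f s].
Proof.
apply: open_nbhs_nbhs; split=> //; exact: (quotient_open [set f s]).
Qed.

End One.

Lemma finite_setT_prod (F1 F2 : choiceType) :
  finite_set [set: F1] -> finite_set [set: F2] -> finite_set [set: F1 * F2].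
Proof. by move=> f1 f2; rewrite -setXTT; exact: finite_setX. Qed.

Lemma quotient_pair (F1 F2 : semigroupType) (f1 : S -> F1) (f2 : S -> F2) :
  finite_quotient f1 -> finite_quotient f2 ->
  finite_quotient (fun s => (f1 s, f2 s)).
Proof.
move=> h1 h2; have [n1 m1 c1] := h1; have [n2 m2 c2] := h2; split.
- exact: (@finite_setT_prod F1 F2 n1 n2).
- by move=> s t; rewrite m1 m2.
- move=> s; apply/discrete_cvg.
  apply: filterS (filterI (quotient_nbhs h1 s) (quotient_nbhs h2 s)) => t [].
  by move=> /= -> ->.
Qed.

Hypothesis hS : profinite_semigroup S.

Lemma profinite_compact : compact [set: S]. Proof. by case: hS. Qed.

Lemma separate u v : (forall (F : semigroupType) (f : S -> F),
  finite_quotient f -> f u = f v) -> u = v.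
Proof.
move=> h; apply: contrapT => /(hS.2) [F [f [fF mf cf]]].
by apply; apply: h.
Qed.

Lemma profinite_hausdorff : hausdorff_space S.
Proof.
move=> u v cl; apply: separate => F f hf.
by have [t [/= -> ->]] := cl _ _ (quotient_nbhs hf u) (quotient_nbhs hf v).
Qed.

(** Finite quotients separate points, so by compactness they give a basis of
   neighbourhoods; pairing two of them makes the family of their fibres directed. *)
Lemma nbhs_quotient s (U : set S) : nbhs s U ->
  exists (F : semigroupType) (f : S -> F),
    finite_quotient f /\ forall t, f t = f s -> U t.
Proof.
move=> sU; apply: contrapT => noq.
pose FF : set_system S := [set W | exists (F : semigroupType) (f : S -> F),
  finite_quotient f /\ [set t | f t = f s] `&` ~` U^° `<=` W].
have q1 : finite_quotient (fun _ : S => 1 : {perm 'I_1}).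
  by split; [exact: finite_finset|move=> *; rewrite mulg1|move=> ?; exact: cvg_cst].
have FFF : ProperFilter FF.
  apply: Build_ProperFilter_ex.
    move=> W [F [f [hf sW]]]; apply: contrapT => We; apply: noq; exists F, f.
    split=> // t ft; apply: contrapT => nUt; apply: We; exists t; apply: sW.
    by split=> // /interior_subset.
  split.
  - by exists {perm 'I_1}, (fun=> 1).
  - move=> W1 W2 [F1 [f1 [h1 s1]]] [F2 [f2 [h2 s2]]].
    exists (F1 * F2)%type, (fun s => (f1 s, f2 s)); split; first exact: quotient_pair.
    by move=> t [[/= e1 e2] nU]; split; [apply: s1|apply: s2].
  - move=> W1 W2 s12 [F [f [hf sW]]]; exists F, f; split=> //.
    exact: subset_trans s12.
have [t [_ ct]] := profinite_compact FFF (@filterT _ _ _).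
have st : t = s.
  apply: separate => F f hf.
  apply: (cluster_closed ct (C := f @^-1` [set f s])); last exact: quotient_closed.
  by exists F, f; split=> // y [].
have : (~` U^°) t.
  apply: (cluster_closed ct); last by apply/open_closedC/open_interior.
  by exists {perm 'I_1}, (fun=> 1); split=> // y [].
by rewrite st; apply.
Qed.

End Quotients.

(** * Idempotents and stability *)

Section Idempotent.
Variable S : topSemigroupType.
Hypothesis hS : profinite_semigroup S.

(** [spow s n] is the power of exponent [n.+1]: a semigroup has no power zero. *)
Definition spow (T : semigroupType) (s : T) (n : nat) : T := iter n (mul s) s.

Lemma spowM (T : semigroupType) (s : T) i j :
  spow s i * spow s j = spow s (i + j).+1.
Proof.
elim: i => [//|i IH]; rewrite addSn /spow iterS -mulgA.
by rewrite -[iter i _ _ * _]/(spow s i * spow s j) IH.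
Qed.

Lemma spow_morph (T U : semigroupType) (f : T -> U) s n :
  {morph f : x y / x * y} -> f (spow s n) = spow (f s) n.
Proof. by move=> mf; elim: n => //= n IH; rewrite mf IH. Qed.

Lemma spow_fact_idem (F : semigroupType) (s : F) : finite_set [set: F] ->
  \forall n \near \oo, spow s (n`!).-1 * spow s (n`!).-1 = spow s (n`!).-1.
Proof.
move=> fF; have [i [j [ltij eij]]] : exists i j, (i < j)%N /\ spow s i = spow s j.
  apply: contrapT => ne; apply: infinite_nat.
  rewrite -(preimage_setT (spow s)); apply: finite_preimage => // a b _ _ eab.
  by case: (ltngtP a b) => // lt; case: ne; [exists a, b|exists b, a].
have per q k : (i <= k)%N -> spow s k = spow s (k + q * (j - i)).
  elim: q k => [|q IH] k ik; first by rewrite addn0.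
  rewrite mulSn addnCA addnA [X in (X + _)%N]addnC -IH; last by rewrite (leq_trans ik) ?leq_addr.
  case: (ltngtP i k) ik => // [ik _|<- _]; last by rewrite subnKC // ltnW.
  have -> : k = (i + (k - i).-1).+1 by rewrite -addnS prednK ?subn_gt0 // subnKC // ltnW.
  rewrite addSn addnAC subnKC ?(ltnW ltij) //.
  by rewrite -!spowM eij.
exists j.+1 => // n /= jn; have fn : (0 < n`!)%N := fact_gt0 n.
have /dvdnP[q eq] : (j - i %| n`!)%N.
  by rewrite dvdn_fact // subn_gt0 ltij (leq_trans (leq_subr _ _)) // ltnW.
rewrite spowM -addnS prednK // {2}eq -per //.
have : (j <= n`!.-1)%N.
  rewrite -ltnS prednK // (leq_trans jn) //.
  by case: n jn {fn eq} => // n _; rewrite factS leq_pmulr ?fact_gt0.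
by apply: leq_trans; exact: ltnW.
Qed.

(** The factorial powers of an element become idempotent in every finite
   quotient, so any of their cluster points is an idempotent. *)
Lemma idempotent_power (s : S) : exists2 e : S, e * e = e &
  forall C : set S, closed C -> (forall n, C (spow s n)) -> C e.
Proof.
have [e ce] := seq_cluster (fun n => spow s (n`!).-1) (profinite_compact hS).
exists e; last by move=> C cC Cs; apply: ce => //; exists 0%N => // n _; exact: Cs.
apply: (separate hS) => F f hf; have [fF mf _] := hf; rewrite mf.
apply: (ce (f @^-1` [set y | y * y = y])); first exact: quotient_closed.
apply: filterS (spow_fact_idem (f s) fF) => n /=.
by rewrite (spow_morph _ _ mf).
Qed.

Lemma closed_idempotent (C : set S) : C !=set0 -> closed C ->
  (forall s t, C s -> C t -> C (s * t)) -> exists2 e, C e & e * e = e.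
Proof.
move=> [s Cs] cC CM; have [e ee he] := idempotent_power s; exists e => //.
by apply: he => //; elim=> //= n IH; exact: CM.
Qed.

End Idempotent.

Section ClosedRelations.
Variable S : topSemigroupType.
Hypothesis hS : profinite_semigroup S.
Let cS := profinite_compact hS.

Lemma cvgM_semigroup (U : topologicalType) (f g : U -> S) :
  continuous f -> continuous g -> continuous (fun u => f u * g u).
Proof.
move=> cf cg u; 
apply: (@continuous2_cvg _ _ _ _ (nbhs u) _ f g (@mul S) (f u) (g u)).
- exact: (@mulg_continuous S (f u, g u)).
- exact: cf.
- exact: cg.
Qed.

Lemma closed_eq_fun (U : topologicalType) (f g : U -> S) :
  continuous f -> continuous g -> closed [set u | f u = g u].
Proof.
move=> cf cg z cz; apply: (separate hS) => F q hq.
have n1 : nbhs z [set u | q (f u) = q (f z)] by exact: cf (quotient_nbhs hq (f z)).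
have n2 : nbhs z [set u | q (g u) = q (g z)] by exact: cg (quotient_nbhs hq (g z)).
by have [u [/= fgu [<- <-]]] := cz _ (filterI n1 n2); rewrite fgu.
Qed.

Lemma continuous_fst (U V : topologicalType) : continuous (@fst U V).
Proof. by move=> z; exact: cvg_fst. Qed.
Lemma continuous_snd (U V : topologicalType) : continuous (@snd U V).
Proof. by move=> z; exact: cvg_snd. Qed.

Lemma closed_preimage (U V : topologicalType) (f : U -> V) (C : set V) :
  continuous f -> closed C -> closed (f @^-1` C).
Proof. by move=> /continuous_closedP; exact. Qed.

(** Division is the projection of a closed set along the compact factor in which
   the quotient lies. *)
Lemma closed_rdiv : closed [set z : S * S | rdiv z.1 z.2].
Proof.
have -> : [set z : S * S | rdiv z.1 z.2] = [set z | z.2 = z.1] `|`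
    [set z | exists y, [set w : S * S * S | w.1.2 = w.1.1 * w.2] (z, y)].
  apply/seteqP; split=> [z [[y|] /= [e]]|z [/= e|[y /= e]]].
  - by right; exists y.
  - by left.
  - by exists None; rewrite /= e.
  - by exists (Some y); rewrite /= e.
apply: closedU; first exact: closed_eq_fun (@continuous_snd _ _) (@continuous_fst _ _).
apply: closed_proj => //.
apply: closed_eq_fun.
  by move=> z; apply: continuous_comp; [exact: continuous_fst|exact: continuous_snd].
apply: cvgM_semigroup; last exact: continuous_snd.
by move=> z; apply: continuous_comp; exact: continuous_fst.
Qed.

Lemma closed_ldiv : closed [set z : S * S | ldiv z.1 z.2].
Proof.
have -> : [set z : S * S | ldiv z.1 z.2] = [set z | z.2 = z.1] `|`
    [set z | exists y, [set w : S * S * S | w.1.2 = w.2 * w.1.1] (z, y)].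
  apply/seteqP; split=> [z [[y|] /= [e]]|z [/= e|[y /= e]]].
  - by right; exists y.
  - by left.
  - by exists None; rewrite /= e.
  - by exists (Some y); rewrite /= e.
apply: closedU; first exact: closed_eq_fun (@continuous_snd _ _) (@continuous_fst _ _).
apply: closed_proj => //.
apply: closed_eq_fun.
  by move=> z; apply: continuous_comp; [exact: continuous_fst|exact: continuous_snd].
apply: cvgM_semigroup; first exact: continuous_snd.
by move=> z; apply: continuous_comp; exact: continuous_fst.
Qed.

Let pairl (U V : topologicalType) (u : U) : continuous (fun v : V => (u, v)).
Proof. by move=> v; apply: cvg_pair; [exact: cvg_cst|exact: cvg_id]. Qed.
Let pairr (U V : topologicalType) (v : V) : continuous (fun u : U => (u, v)).
Proof. by move=> u; apply: cvg_pair; [exact: cvg_id|exact: cvg_cst]. Qed.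

Lemma closed_rdiv_of s : closed [set v : S | rdiv v s].
Proof. exact: (closed_preimage (@pairr _ _ s) closed_rdiv). Qed.
Lemma closed_rdiv_by v : closed [set s : S | rdiv v s].
Proof. exact: (closed_preimage (@pairl _ _ v) closed_rdiv). Qed.
Lemma closed_ldiv_of s : closed [set v : S | ldiv v s].
Proof. exact: (closed_preimage (@pairr _ _ s) closed_ldiv). Qed.
Lemma closed_ldiv_by v : closed [set s : S | ldiv v s].
Proof. exact: (closed_preimage (@pairl _ _ v) closed_ldiv). Qed.

Lemma closed_factor s : closed [set t : S | factor t s].
Proof.
have -> : [set t : S | factor t s] = [set t | exists m,
    ([set z : S * S | ldiv z.1 z.2] `&` [set z | rdiv z.2 s]) (t, m)].
  by apply/seteqP; split=> t /factorE.
apply: closed_proj => //; apply: closedI; first exact: closed_ldiv.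
exact: (closed_preimage (@continuous_snd _ _) (@closed_rdiv_of s)).
Qed.

(** Stability. Iterating [p = a p b] gives [p = a' p d] with [d] an idempotent limit of
   powers of [b]. Hence [p d = p], and [d] is a right multiple of [b]. *)
Lemma stable_right (p : S) (a b : option S) :
  Some p = mul1 (mul1 a (Some p)) b ->
  exists z, Some p = mul1 (mul1 (Some p) b) z.
Proof.
case: b => [b|]; last by exists None.
case: a => [a|] e; last by case: e => e; exists (Some b); rewrite /= -e -e.
have [d dd hd] := idempotent_power hS b.
have : ([set d | rdiv b d] `&` [set d | exists a', p = a' * p * d]) d.
  apply: hd.
    apply: closedI; first exact: closed_rdiv_by.
    have := @closed_proj S S [set z | p = z.2 * p * z.1] cS.
    apply; apply: closed_eq_fun; first by move=> z; exact: cvg_cst.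
    apply: cvgM_semigroup; last exact: continuous_fst.
    by apply: cvgM_semigroup; [exact: continuous_snd|move=> z; exact: cvg_cst].
  elim=> [|n [/= r [a' ea']]].
    by split; [exists None|exists a; case: e].
  split; first by exists (Some (spow b n)).
  exists (a' * a).
  case: e => e; rewrite {1}ea' {1}e /spow /= -[iter _ _ _]/(spow b n).
  by rewrite !mulgA.
move=> [[z ez] [a' ea']]; exists z; rewrite -mul1A -ez /=; congr Some.
by rewrite {1 2}ea' -!mulgA dd !mulgA -ea'.
Qed.

Lemma stable_left (p : S) (a b : option S) :
  Some p = mul1 (mul1 a (Some p)) b ->
  exists z, Some p = mul1 z (mul1 a (Some p)).
Proof.
case: a => [a|]; last by exists None.
case: b => [b|] e; last by case: e => e; exists (Some a); rewrite /= -e -e.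
have [d dd hd] := idempotent_power hS a.
have : ([set d | ldiv a d] `&` [set d | exists b', p = d * p * b']) d.
  apply: hd.
    apply: closedI; first exact: closed_ldiv_by.
    have := @closed_proj S S [set z | p = z.1 * p * z.2] cS.
    apply; apply: closed_eq_fun; first by move=> z; exact: cvg_cst.
    apply: cvgM_semigroup; last exact: continuous_snd.
    by apply: cvgM_semigroup; [exact: continuous_fst|move=> z; exact: cvg_cst].
  elim=> [|n [/= r [b' eb']]].
    by split; [exists None|exists b; case: e].
  split; first by case: r => y ey; exists (mul1 (Some a) y); rewrite -mul1A -ey.
  exists (b' * b).
  by case: e => e; rewrite {1}e {1}eb' !mulgA.
move=> [[z ez] [b' eb']]; exists z; rewrite mul1A -ez /=; congr Some.
by rewrite {1 2}eb' !mulgA dd -eb'.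
Qed.

End ClosedRelations.

(** * Free profinite semigroups and openness of their multiplication *)

HB.instance Definition _ (F : semigroupType) :=
  Semigroup.copy (discrete_topology F) F.

Lemma discrete_continuous (T : choiceType) (U : topologicalType)
  (f : discrete_topology T -> U) : continuous f.
Proof.
move=> t V nV; have Vt := nbhs_singleton nV.
have n1 := @discrete_set1 (discrete_topology T) t.
apply: (filterS _ n1). by move=> _ ->.
Qed.

Fact discrete_mul_continuous (F : semigroupType) :
  continuous (fun uv : discrete_topology F * discrete_topology F => uv.1 * uv.2).
Proof.
move=> [u v] V nV.
exists ([set u], [set v]); first by split; exact: (@discrete_set1 (discrete_topology F)).
by move=> [u' v'] [/= -> ->]; exact: nbhs_singleton nV.
Qed.

HB.instance Definition _ (F : semigroupType) :=
  isTopologicalSemigroup.Build (discrete_topology F) (@discrete_mul_continuous F).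

HB.instance Definition _ (F : groupType) :=
  Group.copy (discrete_topology F) F.
HB.instance Definition _ (F : groupType) :=
  isTopologicalGroup.Build (discrete_topology F)
    (@discrete_continuous F (discrete_topology F) (fun g : F => g^-1)).

Lemma finite_discrete_compact (F : choiceType) : finite_set [set: F] ->
  compact [set: discrete_topology F].
Proof. by move=> fF; exact: finite_compact. Qed.

Lemma finite_profinite_semigroup (F : semigroupType) : finite_set [set: F] ->
  profinite_semigroup (discrete_topology F).
Proof.
move=> fF; split; first exact: finite_discrete_compact.
by move=> u v uv; exists F, id; split=> //; exact: discrete_continuous.
Qed.

Lemma finite_profinite_group (F : groupType) : finite_set [set: F] ->
  profinite_group (discrete_topology F).
Proof.
move=> fF; split; first exact: finite_discrete_compact.
by move=> u v uv; exists F, id; split=> //; exact: discrete_continuous.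
Qed.

Section Words.
Variable A : finType.

(** [pword] for semigroups without a topology, so that words can be evaluated in
   the finite quotients as well. *)
Definition weval (F : semigroupType) (f : A -> F) (w : seq A) : option F :=
  foldr (fun a => mul1 (Some (f a))) None w.

Lemma weval_cons (F : semigroupType) (f : A -> F) a w :
  weval f (a :: w) = mul1 (Some (f a)) (weval f w).
Proof. by []. Qed.

Lemma weval_cat (F : semigroupType) (f : A -> F) u v :
  weval f (u ++ v) = mul1 (weval f u) (weval f v).
Proof. by elim: u => // a u IH; rewrite cat_cons !weval_cons -mul1A -IH. Qed.

Lemma weval_some (F : semigroupType) (f : A -> F) w :
  w <> [::] -> exists s, weval f w = Some s.
Proof. by case: w => [//|a w] _ /=; case: weval => [s|]; eexists. Qed.

Lemma weval_nil (F : semigroupType) (f : A -> F) w s :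
  weval f w = Some s -> w <> [::].
Proof. by case: w. Qed.

Lemma weval_map (F F' : semigroupType) (f : A -> F) (g : F -> F') w :
  {morph g : s t / s * t} -> omap g (weval f w) = weval (g \o f) w.
Proof.
by move=> mg; elim: w => //= a w <-; case: weval => //= s; rewrite mg.
Qed.

Lemma weval_morph (F F' : semigroupType) (f : A -> F) (g : F -> F') w s :
  {morph g : s t / s * t} -> weval f w = Some s -> weval (g \o f) w = Some (g s).
Proof. by move=> mg e; rewrite -weval_map // e. Qed.

End Words.

Section Free.
Variables (A : finType) (S : topSemigroupType) (iota : A -> S).
Hypothesis hS : free_profinite_semigroup iota.
Let pS : profinite_semigroup S := hS.1.

Lemma free_extend (F : semigroupType) (f : A -> F) : finite_set [set: F] ->
  exists2 phi : S -> F, finite_quotient phi & phi \o iota = f.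
Proof.
move=> fF; have [phi [[c m e] _]] :=
  hS.2 (discrete_topology F) f (finite_profinite_semigroup fF).
by exists phi.
Qed.

Lemma free_unique (F : semigroupType) (f g : S -> F) :
  finite_quotient f -> finite_quotient g -> f \o iota = g \o iota -> f = g.
Proof.
move=> [fF mf cf] [_ mg cg] e.
have [phi [_ up]] :=
  hS.2 (discrete_topology F) (f \o iota) (finite_profinite_semigroup fF).
by rewrite -(up f) // -(up g).
Qed.

End Free.

Lemma finite_setT_fset (T : choiceType) : finite_set [set: T] ->
  finite_set [set: {fset T}].
Proof.
move=> fT; apply: (@sub_finite_set _ _ [set` fpowerset (fset_set [set: T])]).
  move=> B _ /=; rewrite fpowersetE; apply/fsubsetP => y _.
  by rewrite in_fset_set //; apply: mem_set.
exact: finite_fset.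
Qed.

Lemma finite_powerset (T : choiceType) : finite_set [set: T] ->
  finite_set [set: set T].
Proof.
move=> fT; rewrite -(preimage_setT (@fset_set T)).
apply: finite_preimage; last exact: finite_setT_fset.
move=> B C _ _; by apply: fset_set_inj; exact: sub_finite_set fT.
Qed.

(** The Schutzenberger product of [F] with itself: besides the value of a word
   it records the values of all the pairs of words into which it can be cut. *)
Definition schutzenberger (F : semigroupType) := (F * set (F * F))%type.

Section Schutzenberger.
Variable F : semigroupType.
Local Notation T := (schutzenberger F).
HB.instance Definition _ := Choice.on T.

Definition schutzenberger_mul (s t : T) : T :=
  (s.1 * t.1, [set (z.1, z.2 * t.1) | z in s.2] `|`
              ([set (s.1 * z.1, z.2) | z in t.2] `|` [set (s.1, t.1)])).

Fact schutzenberger_mulA : associative schutzenberger_mul.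
Proof.
move=> [f P] [g Q] [h R]; rewrite /schutzenberger_mul /= mulgA; congr pair.
rewrite !image_setU !image_set1 /= !image_comp /= -!setUA; congr (_ `|` _).
  by apply: eq_imagel => z _ /=; rewrite mulgA.
congr (_ `|` _); rewrite [RHS]setUC -!setUA; congr (_ `|` _).
by apply: eq_imagel => z _ /=; rewrite mulgA.
Qed.

HB.instance Definition _ := isSemigroup.Build T schutzenberger_mulA.

Lemma schutzenberger_finite : finite_set [set: F] -> finite_set [set: T].
Proof.
by move=> fF; apply: finite_setT_prod => //; apply/finite_powerset/finite_setT_prod.
Qed.

Variables (A : finType) (f : A -> F).
Definition schutzenberger_gen (a : A) : T := (f a, set0).

Lemma schutzenberger_weval w t : weval schutzenberger_gen w = Some t ->
  weval f w = Some t.1 /\ forall z, t.2 z ->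
  exists w1 w2, [/\ w = w1 ++ w2, weval f w1 = Some z.1 & weval f w2 = Some z.2].
Proof.
elim: w t => // a w IH t; rewrite !weval_cons.
case ew: (weval _ w) => [s|] /= [<-]; last first.
  by case: w ew {IH} => [_|b w] /=; [split|case: weval].
have [-> cut] := IH _ ew; split=> // z /= [[y []]|[[y /cut[w1 [w2 [-> e1 e2]]] <-]|->]] //.
- by exists (a :: w1), w2; split=> //; rewrite weval_cons e1.
- exists [:: a], w; split=> //; by have [] := IH _ ew.
Qed.

End Schutzenberger.

Section Lifting.
Variables (A : finType) (S : topSemigroupType) (iota : A -> S).
Hypothesis hS : free_profinite_semigroup iota.
Let pS : profinite_semigroup S := hS.1.

Definition word_image (L : set (seq A)) : set S :=
  [set u | exists2 w, L w & weval iota w = Some u].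

(** This is the openness of the multiplication, in terms of words. A finite quotient
   [f] extends to the Schutzenberger product, where the image of [u * v] contains
   the pair [(f u, f v)]; a word with the same image can therefore be cut into two
   words with images [f u] and [f v]. *)
Lemma lift_factorization (L : set (seq A)) u v (U V : set S) :
  closure (word_image L) (u * v) -> nbhs u U -> nbhs v V ->
  exists w1 w2 s1 s2, [/\ L (w1 ++ w2), weval iota w1 = Some s1,
    weval iota w2 = Some s2, U s1 & V s2].
Proof.
move=> cuv nU nV.
have [F1 [f1 [h1 sU]]] := nbhs_quotient pS nU.
have [F2 [f2 [h2 sV]]] := nbhs_quotient pS nV.
pose F := (F1 * F2)%type : semigroupType; pose f s : F := (f1 s, f2 s).
have hf : finite_quotient f by exact: quotient_pair.
have [fF mf _] := hf.
have [phi hphi ephi] := free_extend hS (schutzenberger_gen (f \o iota))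
  (schutzenberger_finite fF).
have [_ mphi cphi] := hphi.
have e1 : f = fst \o phi.
  apply: (free_unique hS hf) => //; last first.
    by rewrite -compA ephi.
  split=> //; first by move=> s t /=; rewrite mphi.
  move=> s; apply/discrete_cvg.
  by apply: filterS (quotient_nbhs hphi s) => t /= ->.
have [s [[w Lw ew] es]] := cuv _ (quotient_nbhs hphi (u * v)).
have := weval_morph mphi ew; rewrite ephi => /schutzenberger_weval[_].
rewrite es mphi => /(_ ((phi u).1, (phi v).1)) cut.
have [|w1 [w2 [eqw ew1 ew2]]] := cut; first by right; right.
have [s1 es1] : exists s, weval iota w1 = Some s.
  by apply: weval_some; exact: weval_nil ew1.
have [s2 es2] : exists s, weval iota w2 = Some s.
  by apply: weval_some; exact: weval_nil ew2.
exists w1, w2, s1, s2; split=> //; first by rewrite -eqw.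
- apply: sU; move: ew1; rewrite (weval_morph mf es1) => -[].
  by rewrite -[(phi u).1]/((fst \o phi) u) -e1 => -[].
- apply: sV; move: ew2; rewrite (weval_morph mf es2) => -[].
  by rewrite -[(phi v).1]/((fst \o phi) v) -e1 => -[].
Qed.

Lemma closure_factorial (L : set (seq A)) t s :
  (forall u v, L (u ++ v) -> (u <> [::] -> L u) /\ (v <> [::] -> L v)) ->
  closure (word_image L) s -> factor t s -> closure (word_image L) t.
Proof.
move=> facL.
have right u v : closure (word_image L) (u * v) -> closure (word_image L) v.
  move=> cl V nV; have [w1 [w2 [s1 [s2 [L12 e1 e2 _ Vs]]]]] :=
    lift_factorization cl (@filterT _ _ _) nV.
  exists s2; split=> //; exists w2 => //; apply: (facL _ _ L12).2.
  exact: weval_nil e2.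
have left u v : closure (word_image L) (u * v) -> closure (word_image L) u.
  move=> cl V nV; have [w1 [w2 [s1 [s2 [L12 e1 e2 Vs _]]]]] :=
    lift_factorization cl nV (@filterT _ _ _).
  exists s1; split=> //; exists w1 => //; apply: (facL _ _ L12).1.
  exact: weval_nil e1.
by move=> cs [[p|] [[q|] [es]]]; rewrite es in cs; move: cs => //;
  [move/left/right|move/right|move/left].
Qed.

End Lifting.

(** * Finite prefixes and suffixes *)

Section Truncation.
Variables (A : finType) (k : nat).
Implicit Types u v w : seq A.

Lemma take_cat_takel u v : take k (take k u ++ v) = take k (u ++ v).
Proof.
case: (leqP k (size u)) => [le|/ltnW le]; last by rewrite (take_oversize le).
by rewrite [RHS]takel_cat // takel_cat ?take_takel // size_takel.
Qed.

Lemma take_cat_taker u v : take k (u ++ take k v) = take k (u ++ v).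
Proof.
rewrite !take_cat; case: ifP => // _.
by rewrite take_takel ?leq_subr.
Qed.

Lemma size_truncate w : (size (take k w) <= k)%N.
Proof. by rewrite size_take_min geq_minl. Qed.

Definition truncate w : k.-bseq A := Bseq (size_truncate w).

Definition prefixes := k.-bseq A.
HB.instance Definition _ := Finite.on prefixes.
Definition suffixes := k.-bseq A.
HB.instance Definition _ := Finite.on suffixes.

Definition prefixes_mul (s t : prefixes) : prefixes := truncate (s ++ t).
(** Suffixes are stored in reverse, so that truncation always acts on the right. *)
Definition suffixes_mul (s t : suffixes) : suffixes := truncate (t ++ s).

Fact prefixes_mulA : associative prefixes_mul.
Proof.
by move=> s t r; apply: val_inj; rewrite /= take_cat_takel take_cat_taker catA.
Qed.
Fact suffixes_mulA : associative suffixes_mul.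
Proof.
by move=> s t r; apply: val_inj; rewrite /= take_cat_takel take_cat_taker catA.
Qed.
HB.instance Definition _ := isSemigroup.Build prefixes prefixes_mulA.
HB.instance Definition _ := isSemigroup.Build suffixes suffixes_mulA.

Definition prefix_gen (a : A) : prefixes := truncate [:: a].
Definition suffix_gen (a : A) : suffixes := truncate [:: a].

Lemma prefix_weval w t : weval prefix_gen w = Some t -> val t = take k w.
Proof.
elim: w t => // a w IH t; rewrite weval_cons.
case ew: (weval _ w) => [s|] /= [<-] /=; last by case: w ew {IH} => //= b w; case: weval.
by rewrite (IH _ ew) take_cat_takel take_cat_taker.
Qed.

Lemma suffix_weval w t : weval suffix_gen w = Some t -> val t = take k (rev w).
Proof.
elim: w t => // a w IH t; rewrite weval_cons.
case ew: (weval _ w) => [s|] /= [<-] /=; last by case: w ew {IH} => //= b w; case: weval.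
by rewrite (IH _ ew) take_cat_takel take_cat_taker rev_cons -cats1.
Qed.

End Truncation.

Section PrefixNear.
Variables (A : finType) (S : topSemigroupType) (iota : A -> S).
Hypothesis hS : free_profinite_semigroup iota.

(** A finite prefix is visible in the finite semigroup of words truncated at its
   length, so the words near [s] share it. Suffixes behave in the same way. *)
Lemma pprefix_near w s : w <> [::] -> pprefix iota w s ->
  nbhs s [set t | forall w', weval iota w' = Some t -> prefix w w'].
Proof.
move=> wn [q eq]; have [phi hphi ephi] := free_extend hS (@prefix_gen A (size w))
  finite_finset.
have [_ mphi _] := hphi.
have [t et] := weval_some iota wn.
apply: filterS (quotient_nbhs hphi s) => t' /= est w' ew'.
have := weval_morph mphi ew'; rewrite ephi => /prefix_weval; rewrite est => es.
have := weval_morph mphi et; rewrite ephi => /prefix_weval; rewrite take_size => etw.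
suff e : take (size w) w' = w by rewrite -e prefix_take.
rewrite -es; have : s = t \/ exists r, s = t * r.
  by case: q eq => [q|]; rewrite -[pword _ _]/(weval iota w) et => -[->];
    [right; exists q|left].
case=> [->//|[r ->]]; rewrite mphi /= etw take_cat ltnn subnn take0 cats0 //.
Qed.

Lemma psuffix_near w s : w <> [::] -> psuffix iota w s ->
  nbhs s [set t | forall w', weval iota w' = Some t -> suffix w w'].
Proof.
move=> wn [q eq]; have [phi hphi ephi] := free_extend hS (@suffix_gen A (size w))
  finite_finset.
have [_ mphi _] := hphi.
have [t et] := weval_some iota wn.
apply: filterS (quotient_nbhs hphi s) => t' /= est w' ew'.
have := weval_morph mphi ew'; rewrite ephi => /suffix_weval; rewrite est => es.
have := weval_morph mphi et; rewrite ephi => /suffix_weval.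
rewrite [X in _ = X]take_oversize ?size_rev // => etw.
suff e : take (size w) (rev w') = rev w.
  by rewrite /suffix -e prefix_take.
rewrite -es; have : s = t \/ exists r, s = r * t.
  by case: q eq => [q|]; rewrite -[pword _ _]/(weval iota w) et => -[->];
    [right; exists q|left].
case=> [->//|[r ->]]; rewrite mphi /= etw takel_cat ?size_rev // take_oversize ?size_rev //.
Qed.

End PrefixNear.

(** * Minimal subshifts *)

Section Blocks.
Variable A : finType.
Implicit Types (y z : shift_space A) (u v w : seq A) (i j : int).

Lemma size_pos w : w <> [::] -> (0 < size w)%N.
Proof. by case: w. Qed.

Lemma size_block y i n : size (block y i n) = n.
Proof. by rewrite size_map size_iota. Qed.

Lemma block_cat y i m n :
  block y i (m + n) = block y i m ++ block y (i + m%:Z)%R n.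
Proof.
rewrite /block iotaD map_cat; congr cat; rewrite add0n -{1}(addn0 m) iotaDl -map_comp.
by apply: eq_map => k /=; congr y; lia.
Qed.

Lemma nth_block a y i n k : (k < n)%N -> nth a (block y i n) k = y (i + k%:Z)%R.
Proof. by move=> kn; rewrite (nth_map 0%N) ?size_iota // nth_iota. Qed.

Lemma block_nonnil y i n : (0 < n)%N -> block y i n <> [::].
Proof. by move=> n0 /(congr1 size); rewrite size_block /=; lia. Qed.

Lemma eq_block y z i j n : block y i n = block z j n <->
  forall k : nat, (k < n)%N -> y (i + k%:Z)%R = z (j + k%:Z)%R.
Proof.
split=> [e k kn|e]; last first.
  by apply/eq_in_map => k; rewrite mem_iota add0n => /= kn; exact: e.
by rewrite -(nth_block (y 0%R) y i kn) e nth_block.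
Qed.

Lemma take_block y i m n : (m <= n)%N -> take m (block y i n) = block y i m.
Proof. by move=> mn; rewrite -(subnKC mn) block_cat take_size_cat // size_block. Qed.

Lemma block_catP y i n u v : block y i n = u ++ v ->
  u = block y i (size u) /\ v = block y (i + (size u)%:Z)%R (size v).
Proof.
move=> e; have en : n = (size u + size v)%N by rewrite -size_cat -e size_block.
move/eqP: e; rewrite en block_cat eqseq_cat ?size_block // => /andP[/eqP e1 /eqP e2].
by split; apply: esym.
Qed.

Section Language.
Variable X : set (shift_space A).

Lemma language_block y i n : X y -> (0 < n)%N -> language X (block y i n).
Proof. by move=> Xy n0; exists y, i, n. Qed.

Lemma language_size w : language X w -> (0 < size w)%N.
Proof. by move=> [y [i [n [_ n0 ->]]]]; rewrite size_block. Qed.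

Lemma language_factorial u v : language X (u ++ v) ->
  (u <> [::] -> language X u) /\ (v <> [::] -> language X v).
Proof.
move=> [y [i [n [Xy n0 /esym/block_catP[eu ev]]]]].
by split=> /size_pos h; [rewrite eu|rewrite ev]; apply: language_block.
Qed.

Lemma language_mid p u s : language X (p ++ u ++ s) -> u <> [::] -> language X u.
Proof.
move=> /language_factorial[_ h] un; have /h/language_factorial[] : u ++ s <> [::].
  by case: u un {h}.
by move=> + _; exact.
Qed.

End Language.
End Blocks.

Section ShiftTopology.
Variable A : finType.
Implicit Types (y z : shift_space A).

Lemma shift_compact : compact [set: shift_space A].
Proof.
have := @tychonoff int (fun=> discrete_topology A) (fun=> setT).
have -> : [set: shift_space A] = [set f | forall i, [set: discrete_topology A] (f i)].
  by apply/seteqP; split.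
by apply=> _; apply: finite_compact; exact: finite_finset.
Qed.

Definition agree (N : nat) y z := forall k : int, (`|k| <= N)%N -> y k = z k.

Lemma nbhs_coord z (k : int) : nbhs z [set y : shift_space A | y k = z k].
Proof.
exact: (@proj_continuous int (fun=> discrete_topology A) k z _ (discrete_set1 _)).
Qed.

Lemma nbhs_agree z N : nbhs z [set y | agree N y z].
Proof.
elim: N => [|N IH].
  apply: filterS (nbhs_coord z 0%R) => y /= e k.
  by rewrite leqn0 absz_eq0 => /eqP ->.
apply: filterS (filterI IH
  (filterI (nbhs_coord z (N.+1%:Z)%R) (nbhs_coord z (- N.+1%:Z)%R))).
move=> y [/= h [h1 h2]] k kN; have [le|gt] := leqP `|k| N; first exact: h.
have [->|->] // : k = (N.+1%:Z)%R \/ k = (- N.+1%:Z)%R by lia.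
Qed.

Lemma agree_closed (X : set (shift_space A)) z : closed X ->
  (forall N, exists2 y, X y & agree N y z) -> X z.
Proof.
move=> cX h; have h' N : exists y, X y /\ agree N y z by have [y] := h N; exists y.
have [f hf] := choice h'.
have [t ht] := seq_cluster f shift_compact.
suff -> : z = t by apply: ht => //; exists 0%N => // N _; exact: (hf N).1.
apply/funext => k; apply/esym.
apply: (ht [set y : shift_space A | y k = z k]); last first.
  by exists `|k|%N => // N /= kN; exact: (hf N).2.
have -> : [set y : shift_space A | y k = z k] = ~` ~` [set y | y k = z k].
  by rewrite setCK.
apply: open_closedC; rewrite openE => y /= ny.
by apply: filterS (nbhs_coord y k) => y' /= ->.
Qed.

End ShiftTopology.

Section Minimal.
Variables (A : finType) (X : set (shift_space A)).
Hypothesis hX : minimal_subshift X.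
Implicit Types (y z : shift_space A) (u v w : seq A) (i j : int).

Definition translate i y : shift_space A := fun k => y (k + i)%R.

Lemma block_translate i y j n : block (translate i y) j n = block y (j + i)%R n.
Proof. by apply/eq_block => k kn; rewrite /translate; congr y; lia. Qed.

Lemma translate_mem i y : X y -> X (translate i y).
Proof.
have [[_ _ sX] _] := hX.
have up z : X z -> X (translate 1%R z).
  by move=> Xz; rewrite -sX; exists z.
have down z : X z -> X (translate (-1)%R z).
  rewrite -{1}sX => -[z' Xz' <-].
  suff -> : translate (-1)%R (shift_map z') = z' by [].
  by apply/funext => k; rewrite /translate /shift_map; congr z'; lia.
have addT a c z : translate a (translate c z) = translate (c + a)%R z.
  by apply/funext => k; rewrite /translate; congr z; lia.
move=> Xy; case: i => n.
  elim: n => [|n IH]; last first.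
    have -> : Posz n.+1 = (Posz n + 1)%R by lia.
    by rewrite -addT; exact: up.
  by have -> : translate 0%R y = y by apply/funext => k; rewrite /translate GRing.addr0.
elim: n => [|n IH]; first exact: down.
have -> : Negz n.+1 = (Negz n + -1)%R by lia.
by rewrite -addT; exact: down.
Qed.

(** Minimality, applied to the closure of the orbit of [y]. *)
Lemma orbit_dense y z : X y -> X z -> forall N, exists i, agree N z (translate i y).
Proof.
move=> Xy Xz; have [[ne cX sX] minX] := hX.
pose Y : set (shift_space A) := [set z | forall N, exists i, agree N z (translate i y)].
suff e : X = Y by move: Xz; rewrite e.
have YX : Y `<=` X.
  move=> t Yt; apply: agree_closed => // N; have [i hi] := Yt N.
  exists (translate i y); first exact: translate_mem.
  by move=> k kN; rewrite hi.
apply/esym/minX => //; split.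
- by exists y => N; exists 0%R => k _; rewrite /translate GRing.addr0.
- move=> t ct N; have [t' [Yt' att']] := ct _ (nbhs_agree t N).
  have [i hi] := Yt' N; exists i => k kN; rewrite -hi //; apply/esym; exact: att'.
- apply/seteqP; split=> [_ [t Yt <-] N|t Yt].
    have [i hi] := Yt N.+1; exists (i + 1)%R => k kN.
    by rewrite /shift_map hi; [rewrite /translate; congr y; lia|lia].
  exists (translate (-1)%R t); last first.
    by apply/funext => k; rewrite /shift_map /translate; congr t; lia.
  move=> N; have [i hi] := Yt N.+1; exists (i - 1)%R => k kN.
  by rewrite [LHS]/translate hi; [rewrite /translate; congr y; lia|lia].
Qed.

Lemma language_occurs w y : X y -> language X w -> exists i, block y i (size w) = w.
Proof.
move=> Xy [z [j [n [Xz n0 ->]]]]; rewrite size_block.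
have [i hi] := orbit_dense Xy Xz (`|j| + n); exists (j + i)%R.
apply/eq_block => k kn; rewrite hi; first by rewrite /translate; congr y; lia.
by lia.
Qed.

(** By compactness: otherwise some point of [X] would avoid [w] altogether. *)
Lemma uniformly_recurrent w : language X w -> exists N : nat, forall y i, X y ->
  exists2 j, (i <= j <= i + N%:Z)%R & block y j (size w) = w.
Proof.
move=> Lw.
have [N hN] : exists N : nat, forall y, X y ->
    exists2 j : int, (`|j| <= N)%N & block y j (size w) = w.
  apply: contrapT => nN.
  have h N : exists y, X y /\ forall j : int, (`|j| <= N)%N -> block y j (size w) <> w.
    apply: contrapT => ny; apply: nN; exists N => y Xy; apply: contrapT => nj.
    by apply: ny; exists y; split=> // j jN e; apply: nj; exists j.
  have [f hf] := choice h.
  have [t ht] := seq_cluster f (@shift_compact A).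
  have Xt : X t by apply: ht; [case: hX => -[]|exists 0%N => // N _; case: (hf N)].
  have [i hi] := language_occurs Xt Lw.
  suff : [set y | block y i (size w) <> w] t by move/(_ hi).
  apply: ht; last by exists `|i|%N => // N /= iN; exact: (hf N).2.
  have -> : [set y | block y i (size w) <> w] =
    ~` [set y | block y i (size w) = w] by [].
  apply: open_closedC; rewrite openE => y /= e.
  apply: filterS (nbhs_agree y (`|i| + size w)) => y' ag /=; rewrite -e size_block.
  by apply/eq_block => k kn; apply: ag; lia.
exists (N + N)%N => y i Xy.
have [j jN ej] := hN _ (translate_mem (i + N%:Z)%R Xy).
by rewrite block_translate in ej; exists (j + (i + N%:Z))%R; [lia|].
Qed.

End Minimal.

(** * Return words *)

Section Returns.
Variables (A : finType) (X : set (shift_space A)).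
Implicit Types (u v w r s t : seq A).

Lemma catI u v w : u ++ v = u ++ w -> v = w.
Proof. by elim: u => //= a u IH [] /IH. Qed.

Lemma return_word_nonnil u1 u2 v : return_words2 X u1 u2 v -> v <> [::].
Proof.
move=> [_ [r [rn _ _ _] /(congr1 size)]]; rewrite !size_cat => e vn.
by apply: rn; apply: size0nil; move: e; rewrite vn /=; lia.
Qed.

Lemma return_word_prefix u1 u2 v : return_words2 X u1 u2 v ->
  exists t, v ++ u2 = u2 ++ t.
Proof.
move=> [_ [r [_ _ [t _ et] _] e]]; exists t.
by apply: (@catI u1); rewrite !catA e -catA et.
Qed.

Lemma return_word_suffix u1 u2 v : return_words2 X u1 u2 v ->
  exists s, u1 ++ v = s ++ u1.
Proof. by move=> [_ [r _ e]]; exists r. Qed.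

(** A word read between two occurrences of [u1 u2] is cut by the intermediate
   occurrences into return words. *)
Lemma return_decomposition u1 u2 w s t : w <> [::] ->
  language X (u1 ++ w ++ u2) -> w ++ u2 = u2 ++ t -> u1 ++ w = s ++ u1 ->
  u1 ++ u2 <> [::] ->
  exists rs, [/\ rs <> [::], forall r, r \in rs -> return_words2 X u1 u2 r &
                 w = flatten rs].
Proof.
move=> + + + + un; have [n] := ubnP (size w); elim: n w s t => // n IH w s t.
rewrite ltnS => wn wnil Lw ew es.
pose u := u1 ++ u2; pose W := u1 ++ w ++ u2.
have sz : size s = size w by move/(congr1 size): es; rewrite !size_cat; lia.
have WE : W = u ++ t by rewrite /W ew catA.
have occ : exists j, (0 < j <= size w)%N && prefix u (drop j W).
  exists (size w); rewrite leqnn size_pos //= /W catA es -sz -!catA drop_size_cat //.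
  exact: prefix_refl.
case: (ex_minnP occ) => j /andP[/andP[j0 jw] /prefixP[t' et']] jmin.
pose r := take j W; pose v := take j w.
have WE' : W = r ++ u ++ t' by rewrite -et' cat_take_drop.
have szr : size r = j by rewrite size_takel // /W !size_cat; lia.
have er : u1 ++ v = r ++ u1.
  have := congr1 (take (size u1 + j)) WE'.
  rewrite {1}/W take_cat ltnNge leq_addr /= addKn takel_cat // => ->.
  rewrite /u -catA catA take_size_cat // size_cat szr; lia.
have Wn : W <> [::] by rewrite WE /u; case: (u1 ++ u2) un.
have Rr : return_words X u r.
  split.
  - by move=> r0; rewrite r0 in szr; rewrite -szr in j0.
  - move: Lw; rewrite -/W WE' catA => /language_factorial[+ _]; apply.
    by rewrite /u; case: (r) => //=; case: (u1 ++ u2) un.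
  - have e : r ++ u = u ++ take j t.
      have := congr1 (take (size u + j)) WE'.
      rewrite {1}WE take_cat ltnNge leq_addr /= addKn => ->.
      by rewrite catA take_size_cat // size_cat szr addnC.
    exists (take j t) => // t0; move/(congr1 size): e; rewrite t0 !size_cat szr /=; lia.
  - move=> p q e; have [->|pn] := eqVneq p [::]; [by left|right].
    have sp : (size p + size q = j)%N.
      by move/(congr1 size): e; rewrite !size_cat szr; lia.
    have : (0 < size p <= size w)%N && prefix u (drop (size p) W).
      rewrite size_pos ?(introN eqP pn) //=; last exact/eqP.
      rewrite (leq_trans _ jw) -?sp ?leq_addr //= WE' catA e -!catA drop_size_cat //.
      by rewrite (catA u1) prefix_prefix.
    by move=> /jmin jp; apply: size0nil; lia.
have R2v : return_words2 X u1 u2 v.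
  split; last by exists r.
  by rewrite catA er -catA; case: Rr.
have [jeq|jlt] := eqVneq j (size w).
  exists [:: v]; split=> //; last by rewrite /= cats0 /v jeq take_size.
  by move=> r'; rewrite inE => /eqP ->.
pose w' := drop j w.
have wE : w = v ++ w' by rewrite cat_take_drop.
have w'n : w' <> [::] by move/(congr1 size); rewrite size_drop /=; lia.
have WE2 : W = r ++ u1 ++ w' ++ u2 by rewrite /W wE -catA catA er -!catA.
have e' : u1 ++ w' ++ u2 = u ++ t'.
  by apply: (@catI r); rewrite -WE2.
have [|||||rs [rsn hrs erw]] := IH w' (drop j s) t'.
- by rewrite size_drop; lia.
- exact: w'n.
- move: Lw; rewrite -/W WE2 => /language_factorial[_]; apply.
  by case: (w') w'n => //=; case: (u1).
- by apply: (@catI u1); rewrite e' /u -catA.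
- have e2 : r ++ (u1 ++ w') = s ++ u1 by rewrite -es wE !catA er.
  have := congr1 (drop j) e2; rewrite drop_size_cat // => ->.
  by rewrite drop_cat sz; case: ltnP => //; lia.
exists (v :: rs); split=> //; last by rewrite wE erw.
by move=> r'; rewrite inE => /orP[/eqP ->|/hrs].
Qed.

End Returns.

Section ReturnsOfPoint.
Variables (A : finType) (X : set (shift_space A)) (x : shift_space A).
Hypotheses (hX : minimal_subshift X) (hx : X x).
Implicit Types (u v w r s t : seq A) (n k : nat).
Local Notation past n := (block x (- Posz n)%R n).
Local Notation future n := (block x 0%R n).

Lemma past_future m n : past m ++ future n = block x (- Posz m)%R (m + n).
Proof. by rewrite block_cat; congr (_ ++ block _ _ _); lia. Qed.

Lemma future_take m n : (m <= n)%N -> take m (future n) = future m.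
Proof. exact: take_block. Qed.

Lemma past_suffix m n : (m <= n)%N -> suffix (past m) (past n).
Proof.
move=> mn; apply/suffixP; exists (block x (- Posz n)%R (n - m)).
by rewrite -{2}(subnK mn) block_cat; congr (_ ++ block _ _ _); lia.
Qed.

Lemma language_future_factor w : language X w ->
  exists n p s, (0 < n)%N /\ future n = p ++ w ++ s.
Proof.
move=> Lw; have [N hN] := uniformly_recurrent hX Lw.
have [j jN ej] := hN x 0%R hx.
have w0 := language_size Lw.
exists (`|j| + size w)%N, (future `|j|), [::]; split; first by lia.
by rewrite cats0 block_cat; congr (_ ++ _); rewrite -{2}ej; congr block; lia.
Qed.

Lemma language_past_factor w : language X w ->
  exists n p s, (0 < n)%N /\ past n = p ++ w ++ s.
Proof.
move=> Lw; have [N hN] := uniformly_recurrent hX Lw.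
have w0 := language_size Lw.
pose n := (N + size w)%N; have [j jN ej] := hN x (- Posz n)%R hx.
pose d := `|(j + Posz n)%R|%N.
exists n, (block x (- Posz n)%R d), (block x (j + Posz (size w))%R (N - d)).
split; first by rewrite /n; lia.
have -> : past n = block x (- Posz n)%R (d + (size w + (N - d))).
  by congr block; rewrite /d /n; lia.
rewrite !block_cat; congr (_ ++ (_ ++ block _ _ _)); last by rewrite /d /n; lia.
by rewrite -[RHS]ej; congr block; rewrite /d /n; lia.
Qed.

Section Level.
Variable n : nat.
Hypothesis n0 : (0 < n)%N.

Lemma centre_nonnil : past n ++ future n <> [::].
Proof. by move=> /(congr1 size); rewrite size_cat !size_block /=; lia. Qed.

Lemma centre_language : language X (past n ++ future n).
Proof. by rewrite past_future; apply: language_block => //; lia. Qed.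

(** The first return to [u_1 u_2] happens within the recurrence time of that word. *)
Lemma return_bounded : exists M, forall v, Rn X x n v -> (size v <= M)%N.
Proof.
have [N hN] := uniformly_recurrent hX centre_language.
exists N.+1 => v [_ [r [_ [y [i [m [Xy m0 ey]]]] _ once] ev]].
have sv : size v = size r by move/(congr1 size): ev; rewrite !size_cat; lia.
rewrite leqNgt sv; apply/negP => rN.
have [j ij ej] := hN y (i + 1)%R Xy.
pose d := `|(j - i)%R|%N.
have dj : j = (i + Posz d)%R by rewrite /d; lia.
have em : m = (d + (size (past n ++ future n) + (size r - d)))%N.
  by move/(congr1 size): ey; rewrite size_cat size_block /d; lia.
have := once (block y i d)
  (block y (j + Posz (size (past n ++ future n)))%R (size r - d)).
rewrite ey em block_cat -dj block_cat ej => /(_ erefl).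
by case=> /(congr1 size); rewrite size_block /= /d; lia.
Qed.

Lemma Rn_finite : finite_set (Rn X x n).
Proof.
have [M hM] := return_bounded.
apply: (@sub_finite_set _ _ ((fun b : M.-bseq A => val b) @` setT)).
  by move=> v /hM vM; exists (Bseq vM).
exact/finite_image/finite_finset.
Qed.

Lemma Rn_decomposition w : language X (past n ++ w ++ future n) ->
  prefix (future n) w -> suffix (past n) w ->
  exists rs, [/\ rs <> [::], forall r, r \in rs -> Rn X x n r & w = flatten rs].
Proof.
move=> Lw /prefixP[t et] /suffixP[s es].
apply: (@return_decomposition _ _ _ _ _ (past n ++ s) (t ++ future n)) => //.
- by rewrite et => /(congr1 size); rewrite size_cat size_block /=; lia.
- by rewrite et -catA.
- by rewrite {1}es catA.
- exact: centre_nonnil.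
Qed.

Lemma Rn_nonempty : exists v, Rn X x n v.
Proof.
have [N hN] := uniformly_recurrent hX centre_language.
have [j ij /block_catP[ep ef]] := hN x 0%R hx.
rewrite !size_block in ep ef.
pose d := `|j|%N; have dj : j = Posz d by rewrite /d; lia.
have ew : future (d + n) = future d ++ past n.
  by rewrite block_cat ep dj; congr (_ ++ block _ _ _); lia.
have [rs [rsn hrs _]] : exists rs, [/\ rs <> [::],
    forall r, r \in rs -> Rn X x n r & future (d + n) = flatten rs].
  apply: Rn_decomposition.
  - rewrite catA past_future.
    have -> : future n = block x (- Posz n + Posz (n + (d + n)))%R n.
      by rewrite [LHS]ef dj; congr block; lia.
    by rewrite -block_cat; apply: language_block => //; lia.
  - by rewrite addnC block_cat prefix_prefix.
  - by rewrite ew suffix_suffix.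
by case: rs rsn hrs => // r rs _ hrs; exists r; apply: hrs; rewrite inE eqxx.
Qed.

Lemma Rn_language v : Rn X x n v -> language X v.
Proof.
move=> Rv; have [Lv _] := Rv; apply: language_mid Lv _.
exact: return_word_nonnil Rv.
Qed.

Lemma Rn_prefix v k : Rn X x n v -> (k <= size v)%N -> (k <= n)%N ->
  prefix (future k) v.
Proof.
move=> Rv kv kn; have [t /(congr1 (take k))] := return_word_prefix Rv.
rewrite takel_cat // takel_cat ?size_block // take_block // => e.
by rewrite prefixE size_block e.
Qed.

Lemma Rn_suffix v k : Rn X x n v -> (k <= size v)%N -> (k <= n)%N ->
  suffix (past k) v.
Proof.
move=> Rv kv kn; have [s es] := return_word_suffix Rv.
have /suffixP[s' es'] := past_suffix kn.
have : drop (n + size v - k) (past n ++ v) = past k.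
  rewrite es es' catA; apply: drop_size_cat; rewrite size_cat.
  move: (congr1 (@size A) es) (congr1 (@size A) es'); rewrite !size_cat !size_block; lia.
rewrite drop_cat size_block ifF; last by lia.
have -> : (n + size v - k - n = size v - k)%N by lia.
by move=> e; rewrite suffixE size_block e.
Qed.

End Level.

Lemma iter_shift_map k (y : shift_space A) :
  iter k (@shift_map A) y = translate (Posz k) y.
Proof.
apply/funext => i; elim: k i => [|k IH] i /=; first by rewrite /translate GRing.addr0.
by rewrite /shift_map IH /translate; congr y; lia.
Qed.

(** If short return words persisted at arbitrarily deep levels, their common length
   would be a period of [x], and the orbit of [x] would be all of [X]. *)
Lemma Rn_long : ~ periodic X -> forall k, exists M, forall n v,
  (M <= n)%N -> (0 < n)%N -> Rn X x n v -> (k <= size v)%N.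
Proof.
move=> nper k; apply: contrapT => short.
have [l [l0 hl]] : exists l, (0 < l)%N /\ forall M, exists n v,
    [/\ (M <= n)%N, Rn X x n v & size v = l].
  apply: contrapT => nol; apply: short.
  have bound l : (0 < l)%N ->
      exists M, forall n v, (M <= n)%N -> Rn X x n v -> size v <> l.
    move=> l0; apply: contrapT => h; apply: nol; exists l; split=> // M.
    apply: contrapT => h'; apply: h; exists M => n v Mn Rv sv.
    by apply: h'; exists n, v.
  elim: k => [|k [M hM]]; first by exists 0%N.
  have [k0|k0] := posnP k.
    exists 0%N => n v _ _ Rv; rewrite k0; apply: size_pos.
    exact: return_word_nonnil Rv.
  have [M' hM'] := bound k k0; exists (maxn M M') => n v.
  rewrite geq_max => /andP[Mn M'n] n0 Rv.
  by rewrite ltn_neqAle (hM n) // andbT eq_sym; apply/eqP/(hM' n).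
have per i : x (i + Posz l)%R = x i.
  have [n [v [Mn [_ [r [_ _ [t _ et] _] ev]] sv]]] := hl (`|i| + l).+1.
  have sr : size r = l by move/(congr1 (@size A)): ev; rewrite !size_cat; lia.
  rewrite past_future in et.
  pose d := `|(i + Posz n)%R|%N.
  have := congr1 (fun w => nth (x 0%R) w (l + d)) et.
  rewrite nth_cat sr ltnNge leq_addr /= addKn nth_cat size_block ifT; last by lia.
  rewrite !nth_block; [|by lia..].
  move=> e; transitivity (x (- Posz n + Posz (l + d))%R); first by congr x; lia.
  by rewrite -e; congr x; lia.
apply: nper; exists x, l; split=> //.
  by rewrite iter_shift_map; apply/funext => i; rewrite /translate per.
apply/seteqP; split=> [y Xy|_ [k' _ <-]]; last first.
  by rewrite iter_shift_map; exact: translate_mem.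
have hy N : exists k', (k' < l)%N /\ agree N y (translate (Posz k') x).
  have [i hi] := orbit_dense hX hx Xy N.
  have perm (m : nat) j : x (j + Posz (m * l))%R = x j.
    elim: m => [|m IH]; first by rewrite mul0n GRing.addr0.
    by rewrite -[RHS]IH -[RHS]per mulSn; congr x; lia.
  pose b := `|(i + Posz (`|i| * l))%R|%N.
  have e : (i + Posz (`|i| * l) = Posz (b %% l) + Posz (b %/ l * l))%R.
    have : (`|i| <= `|i| * l)%N by rewrite leq_pmulr.
    by have := divn_eq b l; rewrite {1}/b; lia.
  exists (b %% l)%N; split; first by rewrite ltn_mod.
  move=> j jN; rewrite hi // /translate -[LHS](perm `|i|%N) -[RHS](perm (b %/ l)%N).
  by congr x; lia.
apply: contrapT => ny.
have far k' : (k' < l)%N -> exists N, ~ agree N y (translate (Posz k') x).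
  move=> kl; apply: contrapT => h; apply: ny; exists k' => //.
  rewrite iter_shift_map; apply/funext => i; apply/esym.
  apply: contrapT => yi; apply: h; exists `|i|%N => ag; apply: yi.
  exact: ag.
have [N hN] : exists N, forall k', (k' < l)%N -> ~ agree N y (translate (Posz k') x).
  elim: (l) far => [|m IH] far; first by exists 0%N.
  have [|N hN] := IH; first by move=> k' km; apply: far; exact: ltnW.
  have [N' hN'] := far m (ltnSn _); exists (maxn N N') => k'.
  have mono N1 N2 z : (N1 <= N2)%N -> agree N2 y z -> agree N1 y z.
    by move=> le ag i iN; apply: ag; exact: leq_trans le.
  rewrite ltnS leq_eqVlt => /orP[/eqP ->|/hN h] /mono ag.
    by apply: hN'; apply: ag; exact: leq_maxr.
  by apply: h; apply: ag; exact: leq_maxl.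
by have [k' [kl /hN]] := hy N; exact.
Qed.

End ReturnsOfPoint.

(** * Finite quotients of finitely generated free subgroups *)

Section FreeGroupLift.
Variables (A : choiceType) (G : groupType) (f : A -> G).

Lemma FG_lift1 : FG_lift f 1 = 1.
Proof. by rewrite /FG_lift big_nil. Qed.

Lemma FG_liftM g h : FG_lift f (g * h) = FG_lift f g * FG_lift f h.
Proof. exact: FG_lift_is_multiplicative. Qed.

Lemma FG_liftV g : FG_lift f g^-1 = (FG_lift f g)^-1.
Proof. by apply/eqP; rewrite -mulg_eq1 -FG_liftM mulVg FG_lift1. Qed.

Lemma FG_lift_prod (I : Type) (r : seq I) (g : I -> FG A) :
  FG_lift f (\prod_(i <- r) g i) = \prod_(i <- r) FG_lift f (g i).
Proof.
by elim: r => [|i r IH]; rewrite ?big_nil ?FG_lift1 // !big_cons FG_liftM IH.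
Qed.

Lemma FG_lift_letter l : FG_lift f (letter_val (@FG_gen A) l) = letter_val f l.
Proof. by case: l => a []; rewrite /letter_val /= ?FG_liftV FG_lift_gen. Qed.

End FreeGroupLift.

Lemma FG_lift_id (A : choiceType) (g : FG A) : FG_lift (@FG_gen A) g = g.
Proof.
apply: val_inj; case: g => w rw; rewrite /FG_lift /=.
elim: w rw => [|l w IH] rw; first by rewrite big_nil.
rewrite big_cons /= IH; last exact: reduced_behead rw.
have -> : val (letter_val (@FG_gen A) l) = [:: l] by case: l {rw} => a [].
exact: red_consE.
Qed.

(** Multiplying by transpositions one point at a time extends any partial
   injection of a finite set to a permutation. *)
Lemma perm_extension (T : finType) (h : T -> T) (D : seq T) :
  {in D &, injective h} -> exists s : {perm T}, {in D, s =1 h}.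
Proof.
elim: D => [|x D IH] inj; first by exists 1%g.
have [|s hs] := IH; first by move=> y z yD zD; apply: inj; rewrite inE ?yD ?zD orbT.
have [xD|xD] := boolP (x \in D).
  by exists s => y; rewrite inE => /orP[/eqP ->|]; exact: hs.
exists (s * tperm (s x) (h x))%g => y; rewrite inE permM => /orP[/eqP ->|yD].
  by rewrite tpermL.
have yx : y != x by apply: contraNneq xD => <-.
rewrite (hs y yD) tpermD //.
- by rewrite -(hs y yD) (inj_eq perm_inj) eq_sym.
- by apply: contra yx => /eqP/inj ->; rewrite ?inE ?eqxx ?yD ?orbT.
Qed.

Section Hall.
Variables (A I : choiceType) (b : I -> FG A) (Q : groupType) (c : I -> Q).
Hypotheses (fI : finite_set [set: I]) (fQ : finite_set [set: Q]).
Hypothesis injb : injective (FG_lift b).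
Local Notation gen := (@FG_gen A).
Local Notation beta := (FG_lift b).

(** The kernel of [FG_lift c], transported into [FG A], and its right cosets. *)
Let N : set (FG A) := beta @` [set g | FG_lift c g = 1].
Let coset k : set (FG A) := [set m | N (m * k^-1)].

Let image_inj_set (T U : Type) (f : T -> U) : injective f ->
  injective (fun D : set T => f @` D).
Proof.
move=> inj D1 D2 e; apply/seteqP; split=> m hm.
  by have : (f @` D2) (f m) by [rewrite -e; exists m] => -[m' hm' /inj <-].
by have : (f @` D1) (f m) by [rewrite e; exists m] => -[m' hm' /inj <-].
Qed.

Let coset_mul k l : [set m * l | m in coset k] = coset (k * l).
Proof.
apply/seteqP; split=> [_ [m hm <-]|m hm] /=.
  by rewrite /coset /= invgM mulgA mulgK.
by exists (m * l^-1); rewrite ?mulgVK // /coset /= -mulgA -invgM.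
Qed.

Let coset_eq g g' p : FG_lift c g = FG_lift c g' ->
  coset (beta g * p) = coset (beta g' * p).
Proof.
move=> e; rewrite -!coset_mul; congr image; apply/seteqP.
suff sub h h' : FG_lift c h = FG_lift c h' -> coset (beta h) `<=` coset (beta h').
  by split; apply: sub.
move=> eh m [n /= cn em]; exists (n * h * h'^-1) => /=.
  by rewrite !FG_liftM FG_liftV cn eh mul1g mulgV.
by rewrite !FG_liftM em mulgVK FG_liftV.
Qed.

Let coset_inj g g' : coset (beta g) = coset (beta g') -> FG_lift c g = FG_lift c g'.
Proof.
move=> e; have : coset (beta g) (beta g).
  by exists 1; rewrite /= ?FG_lift1 ?mulgV.
rewrite e => -[n /= cn]; rewrite -FG_liftV -FG_liftM => /injb en.
by move: cn; rewrite en FG_liftM FG_liftV => /divg1_eq.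
Qed.

Let word_val (w : seq (A * bool)) : FG A := \prod_(l <- w) letter_val gen l.
Let read : set (FG A) := [set 1] `|`
  \bigcup_(i in [set: I]) ((fun j => word_val (take j (val (b i)))) @`
    `I_(size (val (b i))).+1).
(** The cosets of [N] visited when generators are read letter by letter from the
   cosets of [N] contained in the subgroup. *)
Let E : set (set (FG A)) :=
  [set D | exists g p, read p /\ D = coset (beta g * p)].

(** A coset [N g] in the subgroup depends on the value of [c] at [g] only. *)
Let finite_E : finite_set E.
Proof.
have fread : finite_set read.
  rewrite finite_setU; split; first exact: finite_set1.
  apply: bigcup_finite => // i _.
  exact/finite_image/finite_II.
pose r q := xget 1 [set g | FG_lift c g = q].
apply: (@sub_finite_set _ _ ((fun qp => coset (beta (r qp.1) * qp.2)) @`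
  ([set: Q] `*` read))); last exact/finite_image/finite_setX.
move=> _ [g [p [hp ->]]]; exists (FG_lift c g, p) => //=; apply: coset_eq.
exact: (@xgetPex _ 1 [set h | FG_lift c h = FG_lift c g] (ex_intro _ g erefl)).
Qed.

Let Ef := fset_set E.
Let EfP D : E D -> D \in Ef.
Proof. by move=> ED; rewrite in_fset_set // inE. Qed.

Let read_take i j : read (word_val (take j (val (b i)))).
Proof.
right; exists i => //; have [le|lt] := leqP j (size (val (b i))).
  by exists j => //=; rewrite ltnS.
by exists (size (val (b i))) => //=; rewrite take_size take_oversize // ltnW.
Qed.

Let E_beta g : E (coset (beta g)).
Proof. by exists g, 1; rewrite mulg1; split=> //; left. Qed.

Let letter_perm a : exists s : {perm Ef}, forall e e' : Ef,
  fsval e' = [set m * gen a | m in fsval e] -> s e = e'.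
Proof.
pose h (e : Ef) : Ef := insubd e [set m * gen a | m in fsval e].
pose D := [seq e <- enum {: Ef} | [set m * gen a | m in fsval e] \in Ef].
have hD e : e \in D -> fsval (h e) = [set m * gen a | m in fsval e].
  by rewrite mem_filter => /andP[hin _]; rewrite /h -[LHS]/(val _) val_insubd hin.
have [|s hs] := @perm_extension _ h D.
  move=> e1 e2 /hD h1 /hD h2 /(congr1 (@fsval _ _)); rewrite h1 h2 => e12.
  have inj : injective (fun m => m * gen a) by exact: mulIg.
  by apply: val_inj; exact: image_inj_set e12.
exists s => e e' ee'; have eD : e \in D.
  by rewrite mem_filter mem_enum andbT -ee'; exact: valP.
by rewrite hs //; apply: val_inj; exact: etrans (hD _ eD) (esym ee').
Qed.

Section Action.
Variable f : A -> {perm Ef}.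
Hypothesis hf : forall a (e e' : Ef),
  fsval e' = [set m * gen a | m in fsval e] -> f a e = e'.

(** A letter acts as right multiplication as long as the path stays inside [E]; this
   holds for inverse letters too, because a permutation can be run backwards. *)
Let letter_act l k (e e' : Ef) : fsval e = coset k ->
  fsval e' = coset (k * letter_val gen l) -> letter_val f l e = e'.
Proof.
case: l => a []; rewrite /letter_val /= => ek ek'; last first.
  by apply: hf; rewrite ek' ek coset_mul.
have -> : e = f a e' by symmetry; apply: hf; rewrite ek ek' coset_mul mulgVK.
exact: permK.
Qed.

Let word_act w k (e e' : Ef) : fsval e = coset k ->
  (forall j, E (coset (k * word_val (take j w)))) ->
  fsval e' = coset (k * word_val w) -> (\prod_(l <- w) letter_val f l)%g e = e'.
Proof.
elim: w k e => [|l w IH] k e ek hk ek'.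
  rewrite big_nil perm1; apply: val_inj.
  by rewrite [LHS]ek [RHS]ek' /word_val big_nil mulg1.
rewrite big_cons permM; apply: (IH (k * letter_val gen l)).
- have h1 : E (coset (k * letter_val gen l)).
    by have := hk 1%N; rewrite /word_val /= take0 big_seq1.
  by rewrite (@letter_act l k e (FSetSub (EfP h1))).
- by move=> j; have := hk j.+1; rewrite /word_val /= big_cons mulgA.
- by rewrite ek' /word_val big_cons mulgA.
Qed.

Let generator_act i g (e e' : Ef) : fsval e = coset (beta g) ->
  fsval e' = coset (beta g * b i) -> FG_lift f (b i) e = e'.
Proof.
move=> eg eg'; apply: (word_act eg) => [j|].
  by exists g, (word_val (take j (val (b i)))); split.
by rewrite eg' -[b i in LHS]FG_lift_id.
Qed.

Let lift_act (w : seq (I * bool)) g (e e' : Ef) : fsval e = coset (beta g) ->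
  fsval e' = coset (beta g * \prod_(l <- w) letter_val b l) ->
  FG_lift f (\prod_(l <- w) letter_val b l) e = e'.
Proof.
elim: w g e => [|l w IH] g e eg eg'.
  rewrite big_nil FG_lift1 perm1; apply: val_inj.
  by rewrite [LHS]eg [RHS]eg' big_nil mulg1.
rewrite big_cons FG_liftM permM.
apply: (IH (g * letter_val (@FG_gen I) l)); last first.
  by rewrite eg' big_cons FG_liftM FG_lift_letter mulgA.
have h1 := E_beta (g * letter_val (@FG_gen I) l).
suff -> : FG_lift f (letter_val b l) e = (FSetSub (EfP h1)) by [].
case: l h1 eg' => i [] h1 _; rewrite /letter_val /= in h1 *; last first.
  by apply: (generator_act eg) => /=; rewrite FG_liftM FG_lift_gen.
rewrite FG_liftV.
have -> : e = FG_lift f (b i) (FSetSub (EfP h1)).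
  symmetry; apply: (@generator_act i (g * (FG_gen i)^-1)) => //.
  by rewrite eg FG_liftM FG_liftV FG_lift_gen mulgVK.
exact: permK.
Qed.

Lemma lift_separates g : FG_lift f (beta g) = 1 -> FG_lift c g = 1.
Proof.
move=> fg; pose e1 := FSetSub (EfP (E_beta 1)); pose eg := FSetSub (EfP (E_beta g)).
have : FG_lift f (beta g) e1 = eg.
  by apply: (@lift_act (val g) 1) => //; rewrite [in RHS]FG_lift1 mul1g.
by rewrite fg perm1 => /(congr1 (@fsval _ _)) /coset_inj <-; rewrite FG_lift1.
Qed.

End Action.

(** The profinite topology of a free group induces on a finitely generated free
   subgroup its own profinite topology (M. Hall). If [N] is the kernel in the
   subgroup of a homomorphism to a finite group, finitely many cosets of [N] are
   reached while reading the generators letter by letter. Each letter permutes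
   these cosets partially, and is completed to a permutation; the coset [N] is
   then moved by every element of the subgroup outside [N]. *)
Lemma finite_quotient_extension : exists (T : finType) (f : A -> {perm T}),
  forall g, FG_lift f (FG_lift b g) = 1 -> FG_lift c g = 1.
Proof.
have [f hf] := choice letter_perm.
by exists Ef, f => g; apply: lift_separates.
Qed.

End Hall.

(** * The maximal subgroup at a point *)

Section Kernel.
Variables (A : finType) (X : set (shift_space A)) (x : shift_space A).
Variables (S : topSemigroupType) (iota : A -> S).
Hypotheses (hX : minimal_subshift X) (hXnp : ~ periodic X) (hx : X x).
Hypothesis hS : free_profinite_semigroup iota.
Let pS : profinite_semigroup S := hS.1.
Let cS := profinite_compact pS.
Implicit Types (s t : S) (w u v r : seq A) (n k : nat).
Local Notation past n := (block x (- Posz n)%R n).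
Local Notation future n := (block x 0%R n).
Local Notation CL := (language_closure iota X).

Lemma CL_factor t s : factor t s -> CL s -> CL t.
Proof.
move=> fts cs; apply: (closure_factorial hS) fts => //.
by move=> u v; exact: language_factorial.
Qed.

Lemma CL_word w s : language X w -> weval iota w = Some s -> CL s.
Proof. by move=> Lw ew; apply: subset_closure; exists w. Qed.

Lemma pprefixE w t s : weval iota w = Some t -> pprefix iota w s <-> rdiv t s.
Proof. by rewrite /pprefix /rdiv -[pword iota w]/(weval iota w) => ->. Qed.

Lemma psuffixE w t s : weval iota w = Some t -> psuffix iota w s <-> ldiv t s.
Proof. by rewrite /psuffix /ldiv -[pword iota w]/(weval iota w) => ->. Qed.

Lemma future_val n : (0 < n)%N -> exists t, weval iota (future n) = Some t.
Proof. by move=> n0; exact/weval_some/block_nonnil. Qed.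

Lemma past_val n : (0 < n)%N -> exists t, weval iota (past n) = Some t.
Proof. by move=> n0; exact/weval_some/block_nonnil. Qed.

Lemma closed_pprefix w : w <> [::] -> closed [set s | pprefix iota w s].
Proof.
move=> /(weval_some iota)[t et].
have -> : [set s | pprefix iota w s] = [set s | rdiv t s].
  by apply/seteqP; split=> s /=; rewrite (pprefixE _ et).
exact: closed_rdiv_by.
Qed.

Lemma closed_psuffix w : w <> [::] -> closed [set s | psuffix iota w s].
Proof.
move=> /(weval_some iota)[t et].
have -> : [set s | psuffix iota w s] = [set s | ldiv t s].
  by apply/seteqP; split=> s /=; rewrite (psuffixE _ et).
exact: closed_ldiv_by.
Qed.

Lemma word_pprefix w w' s : prefix w w' -> weval iota w' = Some s -> pprefix iota w s.
Proof.
by move=> /prefixP[v ->] e; exists (weval iota v); rewrite -e weval_cat.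
Qed.

Lemma word_psuffix w w' s : suffix w w' -> weval iota w' = Some s -> psuffix iota w s.
Proof.
by move=> /suffixP[v ->] e; exists (weval iota v); rewrite -e weval_cat.
Qed.

(** Limits of the words [x_0 ... x_(n-1)] and of the words [x_-n ... x_-1]. The
   elements of the group at [x] are R-equivalent to the former and L-equivalent to
   the latter. *)
Lemma future_limit : exists p : S, forall C : set S, closed C ->
  (\forall n \near \oo, forall t, weval iota (future n) = Some t -> C t) -> C p.
Proof.
have h n : exists t, weval iota (future n.+1) = Some t by exact: future_val.
have [f hf] := choice h; have [p hp] := seq_cluster f cS.
exists p => C cC [N _ hN]; apply: hp => //; exists N => // n /= Nn.
by apply: (hN n.+1 _ _ (hf n)); exact: leqW.
Qed.

Lemma past_limit : exists q : S, forall C : set S, closed C ->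
  (\forall n \near \oo, forall t, weval iota (past n) = Some t -> C t) -> C q.
Proof.
have h n : exists t, weval iota (past n.+1) = Some t by exact: past_val.
have [f hf] := choice h; have [p hp] := seq_cluster f cS.
exists p => C cC [N _ hN]; apply: hp => //; exists N => // n /= Nn.
by apply: (hN n.+1 _ _ (hf n)); exact: leqW.
Qed.

Definition future_prefixes s := forall k, (0 < k)%N -> pprefix iota (future k) s.
Definition past_suffixes s := forall k, (0 < k)%N -> psuffix iota (past k) s.

(** Uniform recurrence puts every word of the language into a long enough prefix of
   [s]; being a factor of [s] then passes to limits of words. *)
Lemma future_prefixes_full s t : future_prefixes s -> CL t -> factor t s.
Proof.
move=> fp ct; apply: (closed_factor pS) => U /ct[t' [[w Lw ew] Ut']].
have {}ew : weval iota w = Some t' := ew.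
exists t'; split=> //=; have [n [p [v [n0 en]]]] := language_future_factor hX hx Lw.
have [z ez] := fp n n0; exists (weval iota p), (mul1 (weval iota v) z).
by rewrite ez en -[pword _ _]/(weval _ _) !weval_cat ew !mul1A.
Qed.

Lemma past_suffixes_full s t : past_suffixes s -> CL t -> factor t s.
Proof.
move=> fp ct; apply: (closed_factor pS) => U /ct[t' [[w Lw ew] Ut']].
have {}ew : weval iota w = Some t' := ew.
exists t'; split=> //=; have [n [p [v [n0 en]]]] := language_past_factor hX hx Lw.
have [z ez] := fp n n0; exists (mul1 z (weval iota p)), (weval iota v).
by rewrite ez en -[pword _ _]/(weval _ _) !weval_cat ew !mul1A.
Qed.

(** Requiring only the closure of the language, instead of the J-class in [Gx],
   changes nothing (lemma [GxE]) and makes closedness evident. *)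
Definition group_at : set S :=
  [set s | CL s /\ (future_prefixes s /\ past_suffixes s)].

Lemma pprefix_mul w s t : pprefix iota w s -> pprefix iota w (s * t).
Proof.
by case=> z ez; exists (mul1 z (Some t)); rewrite mul1A -ez.
Qed.

Lemma psuffix_mul w s t : psuffix iota w s -> psuffix iota w (t * s).
Proof.
by case=> z ez; exists (mul1 (Some t) z); rewrite -mul1A -ez.
Qed.

Let closed_imply (b : bool) (C : set S) : (b -> closed C) ->
  closed [set s | b -> C s].
Proof.
case: b => h; last by have -> : [set s | false -> C s] = setT by apply/seteqP; split.
have -> : [set s | true -> C s] = C by apply/seteqP; split=> s /=; [exact|].
exact: h.
Qed.

Lemma closed_group_at : closed group_at.
Proof.
have -> : group_at = CL `&` (\bigcap_k [set s | (0 < k)%N -> pprefix iota (future k) s]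
    `&` \bigcap_k [set s | (0 < k)%N -> psuffix iota (past k) s]).
  apply/seteqP; split=> s [cs [h1 h2]]; split=> //.
    by split=> k _ /=; [exact: h1|exact: h2].
  by split=> k k0; [exact: (h1 k)|exact: (h2 k)].
apply: closedI; first exact: closed_closure.
apply: closedI; apply: closed_bigI => k _.
- apply: (@closed_imply _ [set s | pprefix iota (future k) s]) => k0.
  by apply/closed_pprefix/block_nonnil.
- apply: (@closed_imply _ [set s | psuffix iota (past k) s]) => k0.
  by apply/closed_psuffix/block_nonnil.
Qed.

Section Limits.
Variables p q : S.
Hypothesis hp : forall C : set S, closed C ->
  (\forall n \near \oo, forall t, weval iota (future n) = Some t -> C t) -> C p.
Hypothesis hq : forall C : set S, closed C ->
  (\forall n \near \oo, forall t, weval iota (past n) = Some t -> C t) -> C q.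

Let near_pos (Q : nat -> Prop) :
  (forall n, (0 < n)%N -> Q n) -> \forall n \near \oo, Q n.
Proof. by move=> h; exists 1%N => // n /=; exact: h. Qed.

Let CLp : CL p.
Proof.
apply: hp; first exact: closed_closure; apply: near_pos => n n0 t.
exact/CL_word/language_block.
Qed.

Let CLq : CL q.
Proof.
apply: hq; first exact: closed_closure; apply: near_pos => n n0 t.
exact/CL_word/language_block.
Qed.

Let CLqp : CL (q * p).
Proof.
have cr (u : S) : closed [set s | CL (u * s)].
  apply: (closed_preimage (f := fun s => u * s)); last exact: closed_closure.
  by apply: cvgM_semigroup => s; [exact: cvg_cst|exact: cvg_id].
have cl (u : S) : closed [set s | CL (s * u)].
  apply: (closed_preimage (f := fun s => s * u)); last exact: closed_closure.
  by apply: cvgM_semigroup => s; [exact: cvg_id|exact: cvg_cst].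
apply: (hq (cl p)); apply: near_pos => m m0 t et.
apply: (hp (cr t)); apply: near_pos => n n0 t' et'.
apply: (@CL_word (past m ++ future n)); last by rewrite weval_cat et et'.
by rewrite past_future; apply: language_block => //; lia.
Qed.

Let p_prefixes : future_prefixes p.
Proof.
move=> k k0; apply: hp.
  by apply/closed_pprefix/block_nonnil.
exists k => // n /= kn t; apply: word_pprefix.
by rewrite prefixE size_block future_take.
Qed.

Let q_suffixes : past_suffixes q.
Proof.
move=> k k0; apply: hq.
  by apply/closed_psuffix/block_nonnil.
by exists k => // n /= kn t; apply: word_psuffix; exact: past_suffix.
Qed.

(** By compactness [s] is a right multiple of [p]; as [p] has all words of the
   language as factors, [s] is a factor of [p], and stability applies. *)
Lemma future_rdiv s : CL s -> future_prefixes s -> rdiv p s /\ rdiv s p.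
Proof.
move=> cs fs; have [y ey] : rdiv p s.
  apply: (hp (closed_rdiv_of pS (s := s))); apply: near_pos => n n0 t et.
  by apply/(pprefixE _ et); exact: fs.
split; first by exists y.
have [a [b e]] := future_prefixes_full p_prefixes cs.
have [|z ez] := @stable_right _ pS p a (mul1 y b); first by rewrite mul1A -(mul1A a) -ey.
exists (mul1 b z); rewrite ey -!mul1A; move: ez; rewrite -!mul1A; exact.
Qed.

Lemma past_ldiv s : CL s -> past_suffixes s -> ldiv q s /\ ldiv s q.
Proof.
move=> cs ps; have [y ey] : ldiv q s.
  apply: (hq (closed_ldiv_of pS (s := s))); apply: near_pos => n n0 t et.
  by apply/(psuffixE _ et); exact: ps.
split; first by exists y.
have [a [b e]] := past_suffixes_full q_suffixes cs.
have [|z ez] := @stable_left _ pS q (mul1 a y) b; first by rewrite -(mul1A a) -ey.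
by exists (mul1 z a); rewrite ey !mul1A; move: ez; rewrite !mul1A.
Qed.

(** With [q = b s] and [p = t c], the product [s t] is a factor of [q p], a limit of
   words [x_-m ... x_(n-1)]. *)
Lemma group_at_mul_limits s t : group_at s -> group_at t -> group_at (s * t).
Proof.
move=> [cs [fs ps]] [ct [ft pt]]; split; last first.
  by split=> k k0; [apply: pprefix_mul; exact: fs|apply: psuffix_mul; exact: pt].
have [_ [b eb]] := past_ldiv cs ps; have [_ [c ec]] := future_rdiv ct ft.
apply: CL_factor CLqp; exists b, c.
rewrite -[Some (q * p)]/(mul1 (Some q) (Some p)) eb ec.
by rewrite -[Some (s * t)]/(mul1 (Some s) (Some t)) !mul1A.
Qed.

End Limits.

Lemma group_at_mul s t : group_at s -> group_at t -> group_at (s * t).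
Proof.
have [p hp] := future_limit; have [q hq] := past_limit.
exact: (group_at_mul_limits hp hq).
Qed.

Lemma group_at_rdiv s t : group_at s -> group_at t -> rdiv s t.
Proof.
move=> [cs [fs _]] [ct [ft _]]; have [p hp] := future_limit.
exact: rdiv_trans (future_rdiv hp cs fs).2 (future_rdiv hp ct ft).1.
Qed.

Lemma group_at_ldiv s t : group_at s -> group_at t -> ldiv s t.
Proof.
move=> [cs [_ ps]] [ct [_ pt]]; have [q hq] := past_limit.
exact: ldiv_trans (past_ldiv hq cs ps).2 (past_ldiv hq ct pt).1.
Qed.

(** Deeper and deeper return words accumulate in the group: as they get longer,
   they acquire all the prescribed prefixes and suffixes. *)
Lemma return_cluster (f : nat -> S) :
  (forall n, exists m w, [/\ (n <= m)%N, (0 < m)%N, Rn X x m w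
                            & weval iota w = Some (f n)]) ->
  exists2 t, group_at t & forall C : set S, closed C -> (forall n, C (f n)) -> C t.
Proof.
move=> hf; have [t ht] := seq_cluster f cS; exists t; last first.
  by move=> C cC Cf; apply: ht => //; exists 0%N => // n _; exact: Cf.
have long k : \forall n \near \oo, exists m w,
    [/\ (k <= m)%N, (0 < m)%N, (k <= size w)%N, Rn X x m w & weval iota w = Some (f n)].
  have [M hM] := Rn_long hX hx hXnp k.
  exists (maxn k M) => // n /=; rewrite geq_max => /andP[kn Mn].
  have [m [w [nm m0 Rw ew]]] := hf n; exists m, w; split=> //.
    exact: leq_trans nm.
  by apply: hM Rw => //; exact: leq_trans nm.
have nonnil k : (0 < k)%N -> future k <> [::] /\ past k <> [::].
  by move=> k0; split; exact: block_nonnil.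
split; last split=> k k0.
- apply: ht; first exact: closed_closure; apply: filterS (long 0%N) => n.
  by move=> [m [w [_ _ _ Rw ew]]]; apply: CL_word ew; exact: Rn_language Rw.
- apply: (ht _ (closed_pprefix (nonnil k k0).1)); apply: filterS (long k) => n.
  by move=> [m [w [km m0 kw Rw ew]]]; apply: word_pprefix ew; apply: (Rn_prefix Rw).
- apply: (ht _ (closed_psuffix (nonnil k k0).2)); apply: filterS (long k) => n.
  move=> [m [w [km m0 kw Rw ew]]]; apply: word_psuffix ew.
  by apply: (Rn_suffix _ Rw) => //; exact: m0.
Qed.

Lemma group_at_nonempty : group_at !=set0.
Proof.
have h n : exists s, exists m w, [/\ (n <= m)%N, (0 < m)%N, Rn X x m w
                                    & weval iota w = Some s].
  have [w Rw] := Rn_nonempty hX hx (ltn0Sn n).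
  have [s es] := weval_some iota (return_word_nonnil Rw).
  by exists s, n.+1, w; split=> //; exact: leqnSn.
have [f hf] := choice h; have [t Gt _] := return_cluster hf.
by exists t.
Qed.

Lemma group_at_idempotent : exists2 e, group_at e & e * e = e.
Proof.
exact: (closed_idempotent pS group_at_nonempty closed_group_at group_at_mul).
Qed.

Lemma group_at_unit e s : group_at e -> e * e = e -> group_at s ->
  e * s = s /\ s * e = s.
Proof.
move=> Ge ee Gs; have [y] := group_at_rdiv Ge Gs; have [z] := group_at_ldiv Ge Gs.
move=> ez ey; split.
  by case: y ey => [y|] /= [->]; rewrite ?mulgA ee.
by case: z ez => [z|] /= [->]; rewrite -?mulgA ee.
Qed.

(** All the elements are R- and L-equivalent to an idempotent [e] of the set. If
   [s y = e], then [e y e] is an inverse of [s] in the set: it divides [e], hence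
   belongs to the closure of the language, and it begins and ends as [e] does. *)
Lemma group_at_group : semigroup_subgroup group_at.
Proof.
split; first exact: group_at_mul.
have [e Ge ee] := group_at_idempotent; exists e.
have unit s : group_at s -> e * s = s /\ s * e = s by exact: group_at_unit.
split=> //.
have right s : group_at s -> exists2 t, group_at t & s * t = e.
  move=> Gs; have [[y|] /= [ey]] := group_at_rdiv Gs Ge; last first.
    by exists e; rewrite // -ey.
  have st : s * (e * y * e) = e by rewrite mulgA mulgA (unit s Gs).2 -ey.
  exists (e * y * e) => //; split.
    by apply: CL_factor Ge.1; exists (Some s), None; rewrite /= st.
  split=> k k0; last by apply: psuffix_mul; exact: Ge.2.2.
  by rewrite -mulgA; apply: pprefix_mul; exact: Ge.2.1.
move=> s Gs; have [t Gt st] := right s Gs; exists t; split=> //.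
have [r Gr tr] := right t Gt.
rewrite -[LHS](unit _ (group_at_mul Gt Gs)).2 -tr -(mulgA t) (mulgA s) st.
by rewrite (unit r Gr).1.
Qed.

(** Each element of [group_at] has all of the closure of the language as factors, and
   that closure is factorial: the J-class of the idempotent is the one required. *)
Lemma GxE : Gx iota X x = group_at.
Proof.
have CLfull s t : group_at s -> CL t -> factor t s.
  by move=> [_ [fs _]]; exact: future_prefixes_full.
apply/seteqP; split=> s.
  move=> [[J [_ JL _ Js]] ps]; split; first exact: JL.
  by split=> k k0; have [] := ps k k0.
move=> Gs; have [cs [fs ps]] := Gs; split; last first.
  by move=> k k0; split; [exact: fs|exact: ps].
have [e Ge ee] := group_at_idempotent.
exists (Jclass e); split.
- by exists e => //; exists e; rewrite !ee.
- by move=> t [_ fte]; exact: CL_factor fte Ge.1.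
- by move=> t u [fet _] /(CLfull _ _ Ge) fue; exact: factor_trans fue fet.
- by split; apply: CLfull => //; [exact: Ge.1].
Qed.

(** Writing [s = e s e] with [e] the identity, a word near [s] can be chosen between
   two words that lead from [x_[-n,-1]] and to [x_[0,n-1]]; it is then a product of
   return words. *)
Lemma group_at_returns n s : (0 < n)%N -> group_at s ->
  closure (word_image iota [set w | exists rs, [/\ rs <> [::],
    forall r, r \in rs -> Rn X x n r & w = flatten rs]]) s.
Proof.
move=> n0 Gs U nU; have [e Ge ee] := group_at_idempotent.
have fn : future n <> [::] by exact: block_nonnil.
have pn : past n <> [::] by exact: block_nonnil.
have near_future t : group_at t -> nbhs t
    [set t' | forall w, weval iota w = Some t' -> prefix (future n) w].
  by move=> [_ [ft _]]; apply: (pprefix_near hS fn); exact: ft.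
have near_past t : group_at t -> nbhs t
    [set t' | forall w, weval iota w = Some t' -> suffix (past n) w].
  by move=> [_ [_ pt]]; apply: (psuffix_near hS pn); exact: pt.
pose L1 : set (seq A) := [set w | exists w1, language X (w1 ++ w) /\ suffix (past n) w1].
have cl1 : closure (word_image iota L1) (s * e).
  have := (group_at_mul Ge (group_at_mul Gs Ge)).1 => c1 V nV.
  have [w1 [w2 [s1 [s2 [L12 e1 e2 h1 V2]]]]] :=
    lift_factorization hS c1 (near_past e Ge) nV.
  by exists s2; split=> //; exists w2 => //; exists w1; split=> //; exact: h1.
have [w [w3 [s' [s3 [[w1 [Lw sw1]] ew e3 [Us' [hp hf]] h3]]]]] :=
  lift_factorization hS cl1 (filterI nU (filterI (near_past s Gs) (near_future s Gs)))
    (near_future e Ge).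
exists s'; split=> //; exists w => //.
apply: (Rn_decomposition n0); [|exact: hf|exact: hp].
have /prefixP[t3 et3] := h3 _ e3; have /suffixP[t1 et1] := sw1.
apply: (@language_mid _ _ t1 _ t3); last first.
  by move/(congr1 size); rewrite size_cat size_block /=; lia.
by move: Lw; rewrite et1 et3 -!catA.
Qed.

(** Otherwise return words of arbitrarily deep levels would have their images outside
   the image of the group, and so would their limits, which are in the group. *)
Lemma quotient_returns (F : semigroupType) (f : S -> F) : finite_quotient f ->
  exists M, forall n w t, (M <= n)%N -> (0 < n)%N -> Rn X x n w ->
    weval iota w = Some t -> exists2 g, group_at g & f g = f t.
Proof.
move=> hf; apply: contrapT => noM.
have h M : exists t, (exists m w, [/\ (M <= m)%N, (0 < m)%N, Rn X x m w
    & weval iota w = Some t]) /\ forall g, group_at g -> f g <> f t.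
  apply: contrapT => not; apply: noM; exists M => n w t Mn n0 Rw ew.
  apply: contrapT => nog; apply: not; exists t; split; first by exists n, w.
  by move=> g Gg fg; apply: nog; exists g.
have [u hu] := choice h.
have [t Gt ht] := return_cluster (fun n => (hu n).1).
have : (f @^-1` (~` [set f t])) t.
  apply: ht; first exact: quotient_closed.
  by move=> n fu; exact: (hu n).2 Gt (esym fu).
exact.
Qed.

End Kernel.

(** * The projection to the free profinite group *)

Section GroupOfSubgroup.
Variables (F : semigroupType) (H : set F).
Hypothesis hH : semigroup_subgroup H.

Lemma semigroup_subgroup_groupType : exists (Q : groupType) (val : Q -> F),
  [/\ injective val, {morph val : g h / g * h} & range val = H].
Proof.
have [mulH [e [He unitH invH]]] := hH.
pose T := {y : F | `[< H y >]}.
have HT (y : T) : H (sval y) by apply/asboolP; exact: (svalP y).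
pose mk y (Hy : H y) : T := exist _ y (asboolT Hy).
have h (y : T) : exists z : T, sval z * sval y = e.
  by have [z [Hz _ zy]] := invH _ (HT y); exists (mk z Hz).
have [inv hinv] := choice h.
pose mul (y z : T) := mk _ (mulH _ _ (HT y) (HT z)).
have mA : associative mul by move=> y z t; apply: val_inj; exact: mulgA.
have m1 : left_id (mk e He) mul.
  by move=> y; apply: val_inj; exact: (unitH _ (HT y)).1.
have mr : right_id (mk e He) mul.
  by move=> y; apply: val_inj; exact: (unitH _ (HT y)).2.
have mV : left_inverse (mk e He) inv mul by move=> y; apply: val_inj; exact: hinv.
have mVr : right_inverse (mk e He) inv mul.
  move=> y; rewrite -[mul y _]m1 -{1}(mV (inv y)) -mA (mA (inv y)) mV m1.
  exact: mV.
pose Q : groupType := HB.pack T (isGroup.Build T mA m1 mr mV mVr).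
exists Q, (fun y : Q => sval (y : T)); split.
- by move=> y z; exact: val_inj.
- by [].
- apply/seteqP; split=> [_ [y _ <-]|y Hy]; first exact: HT.
  by exists (mk y Hy).
Qed.

End GroupOfSubgroup.

Section Positive.
Variable A : finType.

Lemma FG_word_cat (u v : seq A) : FG_word (u ++ v) = FG_word u * FG_word v.
Proof. by rewrite /FG_word big_cat. Qed.

Lemma FG_word_flatten (rs : seq (seq A)) :
  FG_word (flatten rs) = \prod_(r <- rs) FG_word r.
Proof.
by elim: rs => [|r rs IH]; rewrite /= ?big_cons ?FG_word_cat ?IH // /FG_word !big_nil.
Qed.

Lemma val_FG_word (w : seq A) : val (FG_word w) = [seq (a, false) | a <- w].
Proof.
elim: w => [|a w IH]; rewrite /FG_word ?big_nil // big_cons /= -/(FG_word w) IH.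
by case: w {IH} => //= b w; case: eqP => // -[].
Qed.

Lemma FG_word_inj : injective (@FG_word A).
Proof.
by move=> u v /(congr1 val); rewrite !val_FG_word => /inj_map; apply=> a b [].
Qed.

Lemma weval_FG (G : groupType) (f : A -> G) w s :
  weval f w = Some s -> FG_lift f (FG_word w) = s.
Proof.
elim: w s => // a w IH s; rewrite weval_cons /FG_word big_cons FG_liftM FG_lift_gen.
case e: weval => [t|] /= [<-]; first by rewrite -(IH _ e).
by case: w e {IH} => [|b w] /=; [rewrite big_nil FG_lift1 mulg1|case: weval].
Qed.

End Positive.

Lemma profinite_group_semigroup (G : topGroupType) :
  profinite_group G -> profinite_semigroup G.
Proof.
move=> [cG sep]; split=> // u v /sep[F [f hf]]; by exists F, f.
Qed.

Theorem theorem6p1 (A : finType) (X : set (shift_space A)) (x : shift_space A)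
  (S : topSemigroupType) (iotaS : A -> S)
  (G : topGroupType) (iotaG : A -> G)
  (pG : S -> G) (K : set (FG A)) (P : set nat)
  (hX : minimal_subshift X) (hXnp : ~ periodic X) (hx : X x)
  (hA : forall a : A, exists2 y, X y & exists i, y i = a)
  (hS : free_profinite_semigroup iotaS)
  (hG : free_profinite_group iotaG)
  (pG_continuous : continuous pG)
  (pG_mul : {morph pG : u v / u * v})
  (pG_iota : forall a, pG (iotaS a) = iotaG a)
  (hK : subgroup K)
  (hP : infinite_set P)
  (hPpos : forall n, P n -> (0 < n)%N)
  (hRn : forall n, P n -> free_basis (@FG_word A @` Rn X x n) K) :
  continuous_isomorphism (Gx iotaS X x) (closure (FG_lift iotaG @` K)) pG.
Proof.
have pS := hS.1; have pGr := profinite_group_semigroup hG.1.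
rewrite (GxE hX hXnp hx hS); set Gp := group_at X x iotaS.
have [mulGp [e [Ge unitGp invGp]]] := group_at_group hX hXnp hx hS.
have deep M : exists n, [/\ P n, (M <= n)%N & (0 < n)%N].
  apply: contrapT => no; apply: hP; apply: (sub_finite_set _ (finite_II M)).
  move=> n Pn /=; rewrite ltnNge; apply/negP => Mn; apply: no.
  by exists n; split=> //; exact: hPpos.
pose B n := @FG_word A @` Rn X x n.
have pG_e : pG e = 1.
  by apply: (mulgI (pG e)); rewrite mulg1 -pG_mul (unitGp e Ge).1.
have KB n r : P n -> Rn X x n r -> K (FG_word r).
  move=> Pn Rr; have [_ <-] := hRn _ Pn.
  have Br : B n (FG_word r) by exists r.
  by exists (FG_gen (SigSub (mem_set Br))) => //; rewrite FG_lift_gen.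
have pG_word w t : weval iotaS w = Some t -> pG t = FG_lift iotaG (FG_word w).
  move=> /(weval_morph pG_mul); have -> : pG \o iotaS = iotaG by apply/funext.
  by move/weval_FG => ->.
(* A compact image of a group is a closed subgroup; to contain [K], it suffices that
   it contains [K] modulo every finite quotient of [G]. *)
pose Gam := pG @` Gp.
have closedGam : closed Gam.
  apply: compact_closed; first exact: profinite_hausdorff pGr.
  apply: continuous_compact; first exact: continuous_subspaceT.
  apply: subclosed_compact (profinite_compact pS) (@subsetT _ _).
  exact: closed_group_at.
have Gam_mul y z : Gam y -> Gam z -> Gam (y * z).
  by move=> [s Gs <-] [t Gt <-]; exists (s * t); [exact: mulGp|exact: pG_mul].
have Gam_inv y : Gam y -> Gam y^-1.
  move=> [s Gs <-]; have [t [Gt st _]] := invGp s Gs; exists t => //.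
  by apply/esym/mulg1_eq; rewrite -pG_mul st.
have Gam1 : Gam 1 by exists e.
have GamE : Gam = closure (FG_lift iotaG @` K).
  apply/seteqP; split=> [_ [s Gs <-] U nU|].
    have [n [Pn _ n0]] := deep 0%N.
    have [t [[w [rs [_ hrs ew]] et] Ut]] :=
      group_at_returns hX hXnp hx hS n0 Gs (pG_continuous s U nU).
    exists (pG t); split=> //; exists (FG_word w); last by rewrite (pG_word _ _ et).
    have [K1 KM _] := hK; rewrite ew FG_word_flatten.
    elim: rs hrs {ew} => [|r rs IH] hrs; rewrite ?big_nil // big_cons.
    apply: KM; first by apply: (KB n r) => //; apply: hrs; rewrite inE eqxx.
    by apply: IH => r' r'in; apply: hrs; rewrite inE r'in orbT.
  apply: (@subset_trans _ (closure Gam)); last exact: closedGam.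
  apply: closure_subset => _ [k Kk <-].
  apply: closedGam => U nU; have [F [f [hf hU]]] := nbhs_quotient pGr nU.
  have [fF mf cf] := hf.
  have hq : finite_quotient (f \o pG).
    split=> //; first by move=> s t /=; rewrite pG_mul mf.
    move=> s; apply/discrete_cvg.
    exact: (pG_continuous s _ (quotient_nbhs hf (pG s))).
  have [M hM] := quotient_returns hX hXnp hx hS hq.
  have [n [Pn Mn n0]] := deep M.
  pose T := [set y | exists2 g, Gam g & f g = f y].
  have T1 : T 1 by exists 1.
  have TM y z : T y -> T z -> T (y * z).
    by move=> [g Gg eg] [h Gh eh]; exists (g * h); rewrite ?mf ?eg ?eh //; exact: Gam_mul.
  have TV y : T y -> T y^-1.
    move=> [g Gg eg]; exists g^-1; first exact: Gam_inv.
    by rewrite -[y^-1]mul1g -(mulVg g) !mf eg -!mf mulgK.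
  suff : T (FG_lift iotaG k) by move=> [g Gg /hU Ug]; exists g.
  have [_ rangeK] := hRn n Pn; move: Kk; rewrite -rangeK => -[g _ <-].
  rewrite [X in FG_lift iotaG X]/FG_lift FG_lift_prod; elim: (val g) => [|l w IH].
    by rewrite big_nil.
  rewrite big_cons; apply: TM IH.
  have Tb (b : B n) : T (FG_lift iotaG (set_val b)).
    have [r Rr er] := set_mem (valP b).
    have [t et] := weval_some iotaS (return_word_nonnil Rr).
    have [y Gy fy] := hM n r t Mn n0 Rr et.
    by exists (pG y); [exists y|rewrite -[set_val b]er -(pG_word _ _ et)].
  case: l => b []; rewrite /letter_val /=; last exact: Tb.
  by rewrite FG_liftV; apply: TV; exact: Tb.
(* A finite quotient [f] maps [Gp] onto a finite group [Q], which contains the image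
   of the free basis of [K] at a deep level. So [f] induces a homomorphism from [K]
   to [Q], and this one is governed by a finite quotient [theta] of [G]. *)
have injG : {in Gp &, injective pG}.
  move=> s t; rewrite !inE => Gs Gt est; apply: (separate pS) => F f hf.
  have [fF mf _] := hf.
  have [M hM] := quotient_returns hX hXnp hx hS hf.
  have [n [Pn Mn n0]] := deep M.
  have [Q [vq [injq mq rq]]] : exists (Q : groupType) (vq : Q -> F),
      [/\ injective vq, {morph vq : g h / g * h} & range vq = f @` Gp].
    apply: semigroup_subgroup_groupType; split.
      move=> _ _ [g Gg <-] [h Gh <-]; exists (g * h); last exact: mf.
      exact: mulGp.
    exists (f e); split; first by exists e.
      by move=> _ [g Gg <-]; rewrite -!mf (unitGp g Gg).1 (unitGp g Gg).2.
    move=> _ [g Gg <-]; have [h [Gh gh hg]] := invGp g Gg.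
    by exists (f h); split; [exists h|rewrite -mf gh|rewrite -mf hg].
  have fQ : finite_set [set: Q].
    by rewrite -(preimage_setT vq); apply: finite_preimage => // y z _ _; exact: injq.
  have fB : finite_set [set: B n].
    have -> : [set: B n] = set_val @^-1` (B n).
      by apply/seteqP; split=> // b _; exact: set_mem (valP b).
    apply: finite_preimage; first by move=> y z _ _; exact: val_inj.
    by apply: finite_image; apply: Rn_finite.
  have cb (b : B n) : exists q : Q, forall r t', Rn X x n r ->
      FG_word r = set_val b -> weval iotaS r = Some t' -> vq q = f t'.
    have [r Rr er] := set_mem (valP b).
    have [t' et'] := weval_some iotaS (return_word_nonnil Rr).
    have [y Gy fy] := hM n r t' Mn n0 Rr et'.
    have : range vq (f y) by rewrite rq; exists y.
    move=> [q _ eq]; exists q => r1 t1 _ er1.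
    have -> : r1 = r by apply: FG_word_inj; rewrite er er1.
    by rewrite et' eq fy => -[->].
  have [c hc] := choice cb.
  have [injb _] := hRn n Pn.
  have [T [h hh]] := finite_quotient_extension c fB fQ injb.
  have fT : finite_set [set: {perm T}] by exact: finite_finset.
  have [theta [[cth mth eth] _]] :=
    hG.2 (discrete_topology {perm T}) h (finite_profinite_group fT).
  have qth : finite_quotient (theta : G -> {perm T}) by [].
  have qpath rs t' : rs <> [::] -> (forall r, r \in rs -> Rn X x n r) ->
      weval iotaS (flatten rs) = Some t' -> exists g : FG (B n),
      vq (FG_lift c g) = f t' /\
      FG_lift (fun b : B n => set_val b) g = FG_word (flatten rs).
    elim: rs t' => // r rs IH t' _ hrs.
    have Rr : Rn X x n r by apply: hrs; rewrite inE eqxx.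
    have Br : B n (FG_word r) by exists r.
    pose b : B n := SigSub (mem_set Br).
    have [t1 et1] := weval_some iotaS (return_word_nonnil Rr).
    have [->|rsn] := eqVneq rs [::].
      rewrite /= cats0 et1 => -[<-]; exists (FG_gen b).
      by rewrite !FG_lift_gen (hc b r t1).
    rewrite /= weval_cat et1; case e2: weval => [t2|] /= [<-]; last first.
      case: (rs) rsn hrs e2 => // r' rs' _ hrs.
      have : Rn X x n r' by apply: hrs; rewrite !inE eqxx orbT.
      move=> /return_word_nonnil.
      by case: (r') => //= a r2 _; case: weval.
    have [||g [eg1 eg2]] := IH _ _ _ e2.
    - exact/eqP.
    - by move=> r' r'in; apply: hrs; rewrite inE r'in orbT.
    exists (FG_gen b * g); rewrite !FG_liftM !FG_lift_gen mq eg1 eg2 (hc b r t1) //.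
    by rewrite mf FG_word_cat.
  have approx s' : Gp s' -> exists g : FG (B n), vq (FG_lift c g) = f s' /\
      FG_lift h (FG_lift (fun b : B n => set_val b) g) = theta (pG s').
    move=> Gs'.
    have nU : nbhs s' [set t' | f t' = f s' /\ theta (pG t') = theta (pG s')].
      apply: filterI (quotient_nbhs hf s') _.
      exact: (pG_continuous s' _ (quotient_nbhs qth (pG s'))).
    have [t' [[w [rs [rsn hrs ew]] et] [e1 e2]]] :=
      group_at_returns hX hXnp hx hS n0 Gs' nU.
    have [g [eg1 eg2]] := qpath rs t' rsn hrs (etrans (congr1 _ (esym ew)) et).
    exists g; rewrite eg1 e1 eg2 -ew -e2; split=> //; apply: weval_FG.
    have mm : {morph (theta \o pG) : u v / u * v >-> (u * v : {perm T})}.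
      by move=> u v /=; rewrite pG_mul mth.
    have := weval_morph mm et; congr (weval _ w = _).
    by rewrite -eth; apply/funext => a /=; rewrite pG_iota.
  have [gs [cs hs]] := approx s Gs; have [gt [ct ht]] := approx t Gt.
  rewrite -cs -ct; congr vq.
  have /hh : FG_lift h (FG_lift (fun b : B n => set_val b) (gs^-1 * gt)) = 1.
    by rewrite FG_liftM FG_liftV FG_liftM FG_liftV hs ht est mulVg.
  by rewrite FG_liftM FG_liftV => /mulg1_eq; rewrite invgK.
split.
- exact: group_at_group.
- by rewrite -GamE; split.
- split=> //; rewrite -GamE; first by move=> s Gs; exists s.
  by move=> y [s Gs <-]; exists s.
- by move=> s t _ _; exact: pG_mul.
- exact: continuous_subspaceT.
Qed.
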